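(* Let $f,g\in L^2(\mathbb{R}^2;\mathbb{H})$ (both also integrable over $\mathbb{R}^2$), with right side quaternion Fourier transforms $\overset{\triangleright}{f},\overset{\triangleright}{g}$. Then the quaternion-valued inner products satisfy $$(f,g)=\frac{1}{(2\pi)^2}\,\big(\overset{\triangleright}{f},\overset{\triangleright}{g}\big).$$
   Context: $\mathbb{H}$ is the real quaternion algebra with units $i,j,k$, $ij=-ji=k$, $jk=-kj=i$, $ki=-ik=j$, $i^2=j^2=k^2=ijk=-1$. For $q=q_r+q_i i+q_j j+q_k k$ with real coefficients, the conjugate is $\tilde q=q_r-q_i i-q_j j-q_k k$ and $|q|=\sqrt{q\tilde q}$. $L^2(\mathbb{R}^2;\mathbb{H})$ is the set of functions $f:\mathbb{R}^2\to\mathbb{H}$ with $\int_{\mathbb{R}^2}|f(\mathbf{x})|^2\,d^2\mathbf{x}<\infty$. The quaternion-valued inner product is $(f,g)=\int_{\mathbb{R}^2}f(\mathbf{x})\,\tilde g(\mathbf{x})\,d^2\mathbf{x}$, where $\tilde g(\mathbf{x})$ is the quaternion conjugate of $g(\mathbf{x})$. For $\mathbf{x}=(x,y)$ and $\mathbf{u}=(u,v)$ in $\mathbb{R}^2$, the right side quaternion Fourier transform (QFTr) of $f$ is $$\overset{\triangleright}{f}(\mathbf{u})=\int_{\mathbb{R}^2}f(\mathbf{x})\,e^{-i xu}\,e^{-j yv}\,d^2\mathbf{x},\qquad d^2\mathbf{x}=dx\,dy.$$ *)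

(* Defs.v *)
From HB Require Import structures.
From mathcomp Require Import all_boot all_order all_algebra.
From mathcomp Require Import ring.
From mathcomp Require Import all_classical all_reals all_analysis.
From mathcomp Require Import measurable_realfun.

Set Implicit Arguments.
Unset Strict Implicit.
Unset Printing Implicit Defensive.

Import Order.TTheory GRing.Theory Num.Theory.
Import numFieldNormedType.Exports HBNNSimple.

Local Open Scope classical_set_scope.
Local Open Scope ring_scope.

Record quat (R : realType) := Quat { qre : R; qim_i : R; qim_j : R; qim_k : R }.

Definition tuple_of_quat (R : realType) (q : quat R) : R * R * R * R :=
  (qre q, qim_i q, qim_j q, qim_k q).

Definition quat_of_tuple (R : realType) (t : R * R * R * R) : quat R :=
  let: (a, b, c, d) := t in Quat a b c d.

Lemma tuple_of_quatK (R : realType) :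
  cancel (@tuple_of_quat R) (@quat_of_tuple R).
Proof. by case. Qed.

HB.instance Definition _ (R : realType) :=
  Choice.copy (quat R) (can_type (@tuple_of_quatK R)).

Definition qadd (R : realType) (p q : quat R) : quat R :=
  Quat (qre p + qre q) (qim_i p + qim_i q)
       (qim_j p + qim_j q) (qim_k p + qim_k q).

Definition qopp (R : realType) (q : quat R) : quat R :=
  Quat (- qre q) (- qim_i q) (- qim_j q) (- qim_k q).

Lemma qaddA (R : realType) : associative (@qadd R).
Proof. by move=> p q r; rewrite /qadd /= !addrA. Qed.

Lemma qaddC (R : realType) : commutative (@qadd R).
Proof. by move=> p q; congr Quat; rewrite addrC. Qed.

Lemma qadd0 (R : realType) : left_id (Quat 0 0 0 0) (@qadd R).
Proof. by case=> a b c d; rewrite /qadd /= !add0r. Qed.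

Lemma qaddN (R : realType) : left_inverse (Quat 0 0 0 0) (@qopp R) (@qadd R).
Proof. by case=> a b c d; rewrite /qadd /= !addNr. Qed.

HB.instance Definition _ (R : realType) :=
  GRing.isZmodule.Build (quat R) (@qaddA R) (@qaddC R) (@qadd0 R) (@qaddN R).

Definition qmul (R : realType) (p q : quat R) : quat R :=
  let: Quat a b c d := p in let: Quat a' b' c' d' := q in
  Quat (a * a' - b * b' - c * c' - d * d')
       (a * b' + b * a' + c * d' - d * c')
       (a * c' - b * d' + c * a' + d * b')
       (a * d' + b * c' - c * b' + d * a').

Lemma qmulA (R : realType) : associative (@qmul R).
Proof. by case=> a b c d [] ? ? ? ? [] ? ? ? ?; congr Quat; ring. Qed.

Lemma qmul1l (R : realType) : left_id (Quat 1 0 0 0) (@qmul R).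
Proof. by case=> a b c d; congr Quat; ring. Qed.

Lemma qmul1r (R : realType) : right_id (Quat 1 0 0 0) (@qmul R).
Proof. by case=> a b c d; congr Quat; ring. Qed.

Lemma qmulDl (R : realType) : left_distributive (@qmul R) (@qadd R).
Proof. by case=> a b c d [] ? ? ? ? [] ? ? ? ?; congr Quat => /=; ring. Qed.

Lemma qmulDr (R : realType) : right_distributive (@qmul R) (@qadd R).
Proof. by case=> a b c d [] ? ? ? ? [] ? ? ? ?; congr Quat => /=; ring. Qed.

Lemma quat1_neq0 (R : realType) : (Quat 1 0 0 0 : quat R) != 0.
Proof. by apply/eqP => -[/eqP]; rewrite oner_eq0. Qed.

HB.instance Definition _ (R : realType) :=
  GRing.Zmodule_isNzRing.Build (quat R)
    (@qmulA R) (@qmul1l R) (@qmul1r R) (@qmulDl R) (@qmulDr R) (@quat1_neq0 R).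

Definition qscale (R : realType) (a : R) (q : quat R) : quat R :=
  Quat (a * qre q) (a * qim_i q) (a * qim_j q) (a * qim_k q).

Lemma qscaleA (R : realType) (a b : R) (q : quat R) :
  qscale a (qscale b q) = qscale (a * b) q.
Proof. by rewrite /qscale /= !mulrA. Qed.

Lemma qscale1 (R : realType) : left_id 1 (@qscale R).
Proof. by case=> a b c d; rewrite /qscale /= !mul1r. Qed.

Lemma qscaleDr (R : realType) : right_distributive (@qscale R) +%R.
Proof. by move=> a p q; rewrite /qscale /= !mulrDr. Qed.

Lemma qscaleDl (R : realType) (q : quat R) :
  {morph (@qscale R)^~ q : a b / a + b}.
Proof. by move=> a b; rewrite /qscale /= !mulrDl. Qed.

HB.instance Definition _ (R : realType) :=
  GRing.Zmodule_isLmodule.Build R (quat R)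
    (@qscaleA R) (@qscale1 R) (@qscaleDr R) (@qscaleDl R).

Lemma qscaleAl (R : realType) (a : R) (p q : quat R) : a *: (p * q) = a *: p * q.
Proof. by case: p => ????; case: q => ????; congr Quat => /=; ring. Qed.

Lemma qscaleAr (R : realType) (a : R) (p q : quat R) : a *: (p * q) = p * (a *: q).
Proof. by case: p => ????; case: q => ????; congr Quat => /=; ring. Qed.

HB.instance Definition _ (R : realType) :=
  GRing.Lmodule_isLalgebra.Build R (quat R) (@qscaleAl R).

HB.instance Definition _ (R : realType) :=
  GRing.Lalgebra_isAlgebra.Build R (quat R) (@qscaleAr R).

Definition quat_i (R : realType) : quat R := Quat 0 1 0 0.
Definition quat_j (R : realType) : quat R := Quat 0 0 1 0.
Definition quat_k (R : realType) : quat R := Quat 0 0 0 1.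

Lemma quatE (R : realType) (q : quat R) :
  q = qre q *: (1 : quat R) + qim_i q *: quat_i R + qim_j q *: quat_j R
      + qim_k q *: quat_k R.
Proof. by case: q => a b c d; congr Quat => /=; ring. Qed.

Lemma quat_units (R : realType) :
  [/\ quat_i R * quat_j R = quat_k R, quat_j R * quat_i R = - quat_k R,
      quat_j R * quat_k R = quat_i R, quat_k R * quat_j R = - quat_i R &
      quat_k R * quat_i R = quat_j R] /\
  [/\ quat_i R * quat_k R = - quat_j R, quat_i R ^+ 2 = - 1,
      quat_j R ^+ 2 = - 1, quat_k R ^+ 2 = - 1 &
      quat_i R * quat_j R * quat_k R = - 1].
Proof. by split; split; rewrite ?expr2; congr Quat => /=; ring. Qed.

Definition qconj (R : realType) (q : quat R) : quat R :=
  Quat (qre q) (- qim_i q) (- qim_j q) (- qim_k q).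

Definition qabs (R : realType) (q : quat R) : R := Num.sqrt (qre (q * qconj q)).

(* q * qconj q is a nonnegative real, so that qabs loses nothing by taking the
   real part. *)
Lemma qmul_conj (R : realType) (q : quat R) :
  q * qconj q =
  (qre q ^+ 2 + qim_i q ^+ 2 + qim_j q ^+ 2 + qim_k q ^+ 2) *: 1.
Proof. by case: q => a b c d; congr Quat => /=; ring. Qed.

(* The exponential series; its limit is taken coefficientwise. *)
Definition qexp (R : realType) (q : quat R) : quat R :=
  let s n := \sum_(0 <= m < n) (m`!%:R^-1 : R) *: q ^+ m in
  Quat (limn (fun n => qre (s n))) (limn (fun n => qim_i (s n)))
       (limn (fun n => qim_j (s n))) (limn (fun n => qim_k (s n))).

(* (t e)^m / m! for an imaginary unit e, in terms of the series of cos, sin *)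
Lemma qexp_termE (R : realType) (e : quat R) (t : R) (m : nat) :
  e ^+ 2 = - 1 ->
  (m`!%:R^-1 : R) *: (t *: e) ^+ m =
  cos_coeff t m *: (1 : quat R) + sin_coeff t m *: e.
Proof.
move=> e2.
have sgE n : e ^+ n.*2 = ((-1) ^+ n : R) *: (1 : quat R).
  rewrite -mul2n exprM e2 -scaleN1r exprZn expr1n.
  by [].
rewrite exprZn scalerA /cos_coeff /sin_coeff /=.
rewrite -[X in e ^+ X]odd_double_half.
have [om|em] := boolP (odd m).
  rewrite /= !mul0r scale0r add0r mul1r add1n exprSr sgE -scalerAl mul1r scalerA.
  congr (_ *: _).
  have -> : m.-1./2 = m./2 by rewrite -[m in LHS]odd_double_half om /= doubleK.
  by rewrite mulrC mulrA mulrAC.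
rewrite /= !mul0r scale0r addr0 mul1r add0n sgE scalerA.
by congr (_ *: _); rewrite mulrC mulrA mulrAC.
Qed.

Lemma qexp_sumE (R : realType) (e : quat R) (t : R) (n : nat) :
  e ^+ 2 = - 1 ->
  \sum_(0 <= m < n) (m`!%:R^-1 : R) *: (t *: e) ^+ m =
  series (cos_coeff t) n *: (1 : quat R) + series (sin_coeff t) n *: e.
Proof.
move=> e2; rewrite /series [X in X *: 1 + _]/= [X in _ + X *: e]/=.
rewrite !scaler_suml -big_split; apply: eq_bigr => m _.
exact: qexp_termE.
Qed.

Lemma qexp_i (R : realType) (t : R) : qexp (t *: quat_i R) = Quat (cos t) (sin t) 0 0.
Proof.
have i2 : quat_i R ^+ 2 = - 1 by case: (quat_units R) => _ [].
rewrite /qexp cos.unlock sin.unlock; congr Quat;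
  [congr (limn _)|congr (limn _)|apply/cvg_lim => //|apply/cvg_lim => //].
- apply/funext => n; by rewrite qexp_sumE //= mulr1 mulr0 addr0.
- apply/funext => n; by rewrite qexp_sumE //= mulr1 mulr0 add0r.
- apply: cvg_near_cst; apply: nearW => n; by rewrite qexp_sumE //= !mulr0 addr0.
- apply: cvg_near_cst; apply: nearW => n; by rewrite qexp_sumE //= !mulr0 addr0.
Qed.

Lemma qexp_j (R : realType) (t : R) : qexp (t *: quat_j R) = Quat (cos t) 0 (sin t) 0.
Proof.
have j2 : quat_j R ^+ 2 = - 1 by case: (quat_units R) => _ [].
rewrite /qexp cos.unlock sin.unlock; congr Quat;
  [congr (limn _)|apply/cvg_lim => //|congr (limn _)|apply/cvg_lim => //].
- apply/funext => n; by rewrite qexp_sumE //= mulr1 mulr0 addr0.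
- apply: cvg_near_cst; apply: nearW => n; by rewrite qexp_sumE //= !mulr0 addr0.
- apply/funext => n; by rewrite qexp_sumE //= mulr1 mulr0 add0r.
- apply: cvg_near_cst; apply: nearW => n; by rewrite qexp_sumE //= !mulr0 addr0.
Qed.

(* The library defines the integral of an arbitrary function, as a supremum over
   simple functions.  It is thus insensitive to changes on a null set even if
   these destroy measurability, and agrees with the integral for the completed
   measure on the functions measurable for the latter. *)
Lemma ge0_ae_le_integral_nonmeasurable (d : measure_display)
    (T : measurableType d) (R : realType) (mu : {measure set T -> \bar R})
    (f g : T -> \bar R) :
  (forall x, 0 <= f x)%E -> (forall x, 0 <= g x)%E ->
  {ae mu, forall x, f x = g x} ->
  (\int[mu]_x f x <= \int[mu]_x g x)%E.
Proof.
move=> f0 g0 [N [mN muN fgN]]; rewrite !ge0_integralTE //.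
apply: ge_ereal_sup => _ [h hf <-].
have mCN : measurable (~` N) by exact: measurableC.
have hCg x : ((proj_nnsfun h mCN x)%:E <= g x)%E.
  rewrite -mrestrict patchE; case: ifPn => [|_]; last exact: g0.
  rewrite inE => Nx; suff <- : f x = g x by exact: hf.
  by apply: contrapT => fgx; apply: Nx; exact: fgN.
have -> : sintegral mu h = sintegral mu (proj_nnsfun h mCN); last first.
  by apply: ereal_sup_ubound; exists (proj_nnsfun h mCN).
rewrite -!integralT_nnsfun; apply: ae_eq_integral => //.
- exact/measurable_EFinP.
- exact/measurable_EFinP.
exists N; split => // x hx; apply: contrapT => Nx; apply: hx => _.
by rewrite -mrestrict patchE mem_set.
Qed.

Lemma ae_eq_integral_nonmeasurable (d : measure_display)
    (T : measurableType d) (R : realType) (mu : {measure set T -> \bar R})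
    (f g : T -> \bar R) :
  {ae mu, forall x, f x = g x} -> (\int[mu]_x f x = \int[mu]_x g x)%E.
Proof.
have ge0 (h k : T -> \bar R) : (forall x, 0 <= h x)%E -> (forall x, 0 <= k x)%E ->
    {ae mu, forall x, h x = k x} -> (\int[mu]_x h x = \int[mu]_x k x)%E.
  move=> h0 k0 hk; apply/eqP; rewrite eq_le; apply/andP; split;
    apply: ge0_ae_le_integral_nonmeasurable => //.
  by apply: filterS hk => x ->.
move=> fg; rewrite integralE [RHS]integralE; congr (_ - _)%E; apply: ge0 => //;
  by apply: filterS fg => x fgx; rewrite ?funeposE ?funenegE fgx.
Qed.

Definition lebesgue2 (R : realType) :
    {measure set (measurableTypeR R * measurableTypeR R) -> \bar R} :=
  (@lebesgue_measure R \x @lebesgue_measure R)%E.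

Definition qintegral (R : realType) (f : R * R -> quat R) : quat R :=
  Quat (\int[lebesgue2 R]_x qre (f x)) (\int[lebesgue2 R]_x qim_i (f x))
       (\int[lebesgue2 R]_x qim_j (f x)) (\int[lebesgue2 R]_x qim_k (f x)).

Definition qmeasurable (R : realType) (f : R * R -> quat R) : Prop :=
  [/\ measurable_fun [set: R * R] (fun x => qre (f x)),
      measurable_fun [set: R * R] (fun x => qim_i (f x)),
      measurable_fun [set: R * R] (fun x => qim_j (f x)) &
      measurable_fun [set: R * R] (fun x => qim_k (f x))].

(* Lebesgue measurability: the library's measurable sets of R * R are the Borel
   sets, and a function is Lebesgue measurable iff it is a.e. equal to a Borel
   function. *)
Definition lebesgue_qmeasurable (R : realType) (f : R * R -> quat R) : Prop :=
  exists2 f0 : R * R -> quat R, qmeasurable f0 &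
    {ae lebesgue2 R, forall x, f x = f0 x}.

Definition in_L1 (R : realType) (f : R * R -> quat R) : Prop :=
  lebesgue_qmeasurable f /\ (\int[lebesgue2 R]_x (qabs (f x))%:E < +oo)%E.

Definition in_L2 (R : realType) (f : R * R -> quat R) : Prop :=
  lebesgue_qmeasurable f /\ (\int[lebesgue2 R]_x (qabs (f x) ^+ 2)%:E < +oo)%E.

Definition qinner (R : realType) (f g : R * R -> quat R) : quat R :=
  qintegral (fun x => f x * qconj (g x)).

Definition qftr (R : realType) (f : R * R -> quat R) (u : R * R) : quat R :=
  qintegral (fun x =>
    f x * qexp (- (x.1 * u.1) *: quat_i R) * qexp (- (x.2 * u.2) *: quat_j R)).

Lemma qintegral_ae_eq (R : realType) (f g : R * R -> quat R) :
  {ae lebesgue2 R, forall x, f x = g x} -> qintegral f = qintegral g.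
Proof.
move=> fg; congr Quat; congr fine; apply: ae_eq_integral_nonmeasurable;
  by apply: (@filterS _ _ (ae_filter_ringOfSetsType (lebesgue2 R)) _ _ _ fg) => x ->.
Qed.

(* Main.v *)
(* The transform is iterated: first in [x], multiplying on the right by
   [e^{-i x u}], then in [y], multiplying by [e^{-j y v}].  Each step only mixes
   two pairs of real components, so Plancherel's identity
   [|f^|^2 = (2 pi)^2 |f|^2] follows from the one-dimensional identity, applied to
   almost every section, and Tonelli's theorem.  In dimension one, inserting the
   weight [e^{-e|u|}] turns the integral of [|a^|^2] into a Poisson average of the
   autocorrelation [s |-> \int a x * a (x + s)], and [e --> 0] is justified by the
   continuity of translations in [L^2].  The inner products are recovered by
   polarization; their imaginary components are the real parts of left multiples
   by [-i], [-j], [-k], and left multiplication commutes with the transform. *)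

Require Import Defs.
From mathcomp Require Import all_boot all_order all_algebra.
From mathcomp Require Import ring lra.
From mathcomp Require Import all_classical all_reals all_analysis.
From mathcomp Require Import measurable_realfun.

Set Implicit Arguments.
Unset Strict Implicit.
Unset Printing Implicit Defensive.

Import Order.TTheory GRing.Theory Num.Theory.
Import numFieldNormedType.Exports.

Local Open Scope classical_set_scope.
Local Open Scope ring_scope.

(** * Real-valued integrals *)

(** The obstacle is the second step of the iteration: the transform of [f] in [x] alone need not be
    integrable over the plane, so the hypotheses of the first step do not reproduce themselves. What
    survives is weaker. For every frequency [u] the partial transform is integrable in [y], and it
    is square integrable over the plane because the first Plancherel identity has a finite right
    side. The one-dimensional identity is therefore carried to the plane under integrability of
    almost all sections and square integrability of the whole. The units [i] and [j] do not commute,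
    so no single complex-valued transform covers both steps; real cosine and sine transforms do. The
    weight $e^{-e|u|}$ is chosen because its transform, the Poisson kernel, comes from an elementary
    antiderivative; $2\pi$ enters as the integral of $2/(1+t^2)$. Real-valued integrals take the
    value [0] when they would be infinite. Measurability and scaling are proved without
    integrability, since they are applied on every section whereas integrability is known on almost
    all of them. *)

Section integral_tools.
Context d (T : measurableType d) (R : realType).
Variable mu : {measure set T -> \bar R}.
Implicit Types f g : T -> R.

Lemma integrable_le_norm f g : measurable_fun [set: T] f ->
  mu.-integrable [set: T] (EFin \o g) -> (forall x, `|f x| <= g x) ->
  mu.-integrable [set: T] (EFin \o f).
Proof.
move=> mf ig fg; apply: le_integrable ig => //; first exact/measurable_EFinP.
by move=> x _ /=; rewrite lee_fin (le_trans (fg x))// ler_norm.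
Qed.

Lemma integrableT_norm_lty f : measurable_fun [set: T] f ->
  (\int[mu]_x `|f x|%:E < +oo)%E -> mu.-integrable [set: T] (EFin \o f).
Proof. by move=> mf foo; apply/integrableP; split => //; exact/measurable_EFinP. Qed.

Lemma ge0_integrableT_lty f : measurable_fun [set: T] f -> (forall x, 0 <= f x) ->
  (\int[mu]_x (f x)%:E < +oo)%E -> mu.-integrable [set: T] (EFin \o f).
Proof.
move=> mf f0 foo; apply: integrableT_norm_lty => //.
by under eq_integral do rewrite ger0_norm//.
Qed.

Lemma integrableT_measurable f : mu.-integrable [set: T] (EFin \o f) ->
  measurable_fun [set: T] f.
Proof. by move/measurable_int/measurable_EFinP. Qed.

Lemma integrableT_scale (k : R) f : mu.-integrable [set: T] (EFin \o f) ->
  mu.-integrable [set: T] (EFin \o (fun x => k * f x)).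
Proof. by move=> fi; exact: (integrableZl measurableT k fi). Qed.

Lemma integrableT_bounded_mul f g (M : R) :
  mu.-integrable [set: T] (EFin \o f) -> measurable_fun [set: T] g ->
  (forall x, `|g x| <= M) -> mu.-integrable [set: T] (EFin \o (fun x => f x * g x)).
Proof.
move=> fi mg gM; have mf := integrableT_measurable fi.
apply: (@integrable_le_norm _ (fun x => M * `|f x|)).
- exact: measurable_funM.
- exact/integrableT_scale/integrable_norm.
- by move=> x; rewrite normrM mulrC ler_wpM2r.
Qed.

Lemma integrableT_add f g : mu.-integrable [set: T] (EFin \o f) ->
  mu.-integrable [set: T] (EFin \o g) ->
  mu.-integrable [set: T] (EFin \o (fun x => f x + g x)).
Proof.
move=> fi gi.
by refine (eq_integrable measurableT _ _ _ (integrableD measurableT fi gi)).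
Qed.

Lemma integrableT_opp f : mu.-integrable [set: T] (EFin \o f) ->
  mu.-integrable [set: T] (EFin \o (fun x => - f x)).
Proof. move=> fi; by refine (eq_integrable measurableT _ _ _ (integrableN fi)). Qed.

Lemma integrableT_sub f g : mu.-integrable [set: T] (EFin \o f) ->
  mu.-integrable [set: T] (EFin \o g) ->
  mu.-integrable [set: T] (EFin \o (fun x => f x - g x)).
Proof.
move=> fi gi.
by refine (eq_integrable measurableT _ _ _ (integrableB measurableT fi gi)).
Qed.

Lemma integrableT_mul f g :
  measurable_fun [set: T] f -> measurable_fun [set: T] g ->
  mu.-integrable [set: T] (EFin \o (fun x => f x ^+ 2)) ->
  mu.-integrable [set: T] (EFin \o (fun x => g x ^+ 2)) ->
  mu.-integrable [set: T] (EFin \o (fun x => f x * g x)).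
Proof.
move=> mf mg fi gi; apply: integrable_le_norm (integrableT_add fi gi) _.
  exact: measurable_funM.
move=> x; rewrite ler_norml; have := sqr_ge0 (f x + g x).
have := sqr_ge0 (f x - g x); have := sqr_ge0 (f x); have := sqr_ge0 (g x).
by move=> *; apply/andP; split; nra.
Qed.

(* No hypothesis: if the positive and negative parts both have infinite
   integrals then both sides are [0]. *)
Lemma RintegralN f : \int[mu]_x (- f x) = - \int[mu]_x f x.
Proof.
rewrite /Rintegral -fineN integralE [in RHS]integralE.
have -> : (fun x => (- f x)%:E)^\+%E = (fun x => (f x)%:E)^\-%E.
  by apply/funext => x; rewrite funeposE funenegE.
have -> : (fun x => (- f x)%:E)^\-%E = (fun x => (f x)%:E)^\+%E.
  by apply/funext => x; rewrite funeposE funenegE -EFinN opprK.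
have := @integral_ge0 _ _ _ mu setT _ (fun x _ => funepos_ge0 (fun x => (f x)%:E) x).
have := @integral_ge0 _ _ _ mu setT _ (fun x _ => funeneg_ge0 (fun x => (f x)%:E) x).
case: (\int[mu]_x _)%E => [r||]// _; case: (\int[mu]_x _)%E => [s||]//= _.
by rewrite opprB.
Qed.

Lemma integrableT_EFin_Rintegral f : mu.-integrable [set: T] (EFin \o f) ->
  (\int[mu]_x (f x)%:E = (\int[mu]_x f x)%:E)%E.
Proof. by move=> fi; rewrite fineK//; exact: integrable_fin_num. Qed.

End integral_tools.

(** * Fubini's theorem for real-valued integrals *)

Section measurable_Rintegral.
Context d1 d2 (T1 : measurableType d1) (T2 : measurableType d2) (R : realType).
Variable m2 : {sigma_finite_measure set T2 -> \bar R}.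
Variable f : T1 * T2 -> R.

(** Tonelli's theorem makes the integrals of the positive and negative parts measurable in [x].
    Their difference and then [fine] preserve this, whatever the values at those [x] whose section
    is not integrable. *)
Lemma measurable_Rintegral2 : measurable_fun [set: T1 * T2] f ->
  measurable_fun [set: T1] (fun x => \int[m2]_y f (x, y)).
Proof.
move=> mf; have mEf : measurable_fun [set: T1 * T2] (EFin \o f).
  exact/measurable_EFinP.
apply: (@measurableT_comp _ _ _ _ _ _ fine _
  (fun x => \int[m2]_y (f (x, y))%:E)%E) => //.
have -> : (fun x => \int[m2]_y (f (x, y))%:E)%E = (fubini_F m2 (EFin \o f)^\+ \-
    fubini_F m2 (EFin \o f)^\-)%E.
  apply/funext => x; rewrite integralE; congr (_ - _)%E; apply: eq_integral => y _.
    by rewrite !funeposE.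
  by rewrite !funenegE.
apply: emeasurable_funB.
  by apply: measurable_fun_fubini_tonelli_F => //; exact: measurable_funepos.
by apply: measurable_fun_fubini_tonelli_F => //; exact: measurable_funeneg.
Qed.

End measurable_Rintegral.

Section fubini_real.
Context d1 d2 (T1 : measurableType d1) (T2 : measurableType d2) (R : realType).
Variable m1 : {sigma_finite_measure set T1 -> \bar R}.
Variable m2 : {sigma_finite_measure set T2 -> \bar R}.
Variable f : T1 * T2 -> R.
Hypothesis fi : (m1 \x m2)%E.-integrable [set: T1 * T2] (EFin \o f).

(** Passing from the extended to the real inner integral replaces infinite values by [0], which can
    only decrease the absolute value. *)
Lemma integrable_Rintegral2 :
  m1.-integrable [set: T1] (EFin \o (fun x => \int[m2]_y f (x, y))).
Proof.
have mf := integrableT_measurable fi.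
apply: le_integrable (integrable_fubini_F fi) => //.
  by apply/measurable_EFinP; exact: measurable_Rintegral2.
move=> x _ /=; rewrite /Rintegral /fubini_F /=.
by case: (\int[m2]_y _)%E => [r||]//=; rewrite normr0 leey.
Qed.

Lemma Rintegral12_prod : \int[m1]_x \int[m2]_y f (x, y) = \int[(m1 \x m2)%E]_z f z.
Proof.
have mf := integrableT_measurable fi.
rewrite /Rintegral -(integral12_prod_meas1 fi); congr fine.
apply: ae_eq_integral => //.
- by apply/measurable_EFinP; exact: measurable_Rintegral2.
- exact: (measurable_fubini_F fi).
(* The real and extended inner integrals are only known to agree where the section is integrable,
   that is for almost every [x]. *)
- have := ae_integrable1 fi; apply: filterS => x fxi _.
  exact/esym/integrableT_EFin_Rintegral.
Qed.

Lemma Rintegral21_prod : \int[m2]_y \int[m1]_x f (x, y) = \int[(m1 \x m2)%E]_z f z.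
Proof.
have mf := integrableT_measurable fi.
rewrite /Rintegral -(integral21_prod_meas1 fi); congr fine.
apply: ae_eq_integral => //.
- apply/measurable_EFinP.
  apply: (@measurable_Rintegral2 _ _ T2 T1 _ m1 (fun z => f (z.2, z.1))).
  by apply: measurableT_comp => //; exact: measurable_fun_pair.
- exact: (measurable_fubini_G fi).
- have := ae_integrable2 fi; apply: filterS => x fxi _.
  exact/esym/integrableT_EFin_Rintegral.
Qed.

Lemma Rintegral_fubini :
  \int[m1]_x \int[m2]_y f (x, y) = \int[m2]_y \int[m1]_x f (x, y).
Proof. by rewrite Rintegral12_prod Rintegral21_prod. Qed.

End fubini_real.

(** A bound by a product of integrable functions of one variable justifies the interchanges of
    integrals in [Rintegral_cos_sin_transform_sqr]. *)
Lemma integrable_prod_mul d1 d2 (T1 : measurableType d1) (T2 : measurableType d2)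
    (R : realType) (m1 : {sigma_finite_measure set T1 -> \bar R})
    (m2 : {sigma_finite_measure set T2 -> \bar R}) (f : T1 * T2 -> R)
    (p : T1 -> R) (q : T2 -> R) :
  measurable_fun [set: T1 * T2] f ->
  m1.-integrable [set: T1] (EFin \o p) -> m2.-integrable [set: T2] (EFin \o q) ->
  (forall x y, `|f (x, y)| <= p x * q y) ->
  (m1 \x m2)%E.-integrable [set: T1 * T2] (EFin \o f).
Proof.
move=> mf ip iq fpq; apply/(integrable12ltyP m1 m2).
  exact/measurable_EFinP.
have mp := integrableT_measurable ip; have mq := integrableT_measurable iq.
have np := integrable_norm ip; have nq := integrable_norm iq.
apply: (@le_lt_trans _ _ (\int[m1]_x \int[m2]_y (`|p x| * `|q y|)%:E)%E).
  apply: ge0_le_integral => //.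
  - by move=> x _; exact: integral_ge0.
  - apply: (@measurable_fun_fubini_tonelli_F _ _ _ _ _ _ (fun z => `|f z|%:E)%E) => //.
    exact/measurable_EFinP/measurableT_comp.
  - apply: (@measurable_fun_fubini_tonelli_F _ _ _ _ _ _
      (fun z => (`|p z.1| * `|q z.2|)%:E)%E) => [|z]; last by rewrite lee_fin mulr_ge0.
    apply/measurable_EFinP/measurable_funM.
      by apply: measurableT_comp => //; exact: measurableT_comp.
    by apply: measurableT_comp => //; exact: measurableT_comp.
  - move=> x _; apply: ge0_le_integral => //.
    + exact/measurable_EFinP/measurableT_comp/measurable_fun_pair2.
    + by apply/measurable_EFinP/measurable_funM => //; exact: measurableT_comp.
    + move=> y _; rewrite lee_fin (le_trans (fpq x y))//.
      by rewrite -normrM ler_norm.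
under eq_integral => x _.
  under eq_integral do rewrite EFinM.
  rewrite ge0_integralZl//; last first.
    by apply/measurable_EFinP; exact: measurableT_comp.
  rewrite (integrableT_EFin_Rintegral nq) -EFinM mulrC.
  over.
rewrite -/(EFin \o _) integrableT_EFin_Rintegral ?ltry//.
exact: integrableT_scale.
Qed.

(** * Affine changes of variables *)

Section lebesgue_change_of_variables.
Variable R : realType.
Notation mu := (@lebesgue_measure R).

Lemma measurable_affine (r c : R) :
  measurable_fun [set: measurableTypeR R] (fun x => r * x + c : measurableTypeR R).
Proof. by apply: measurable_funD => //; exact: measurable_funM. Qed.

(** The image of the Lebesgue measure under $x \mapsto rx + c$, multiplied by [r]. By uniqueness,
    its values on the intervals $]a,b]$ identify it with the Lebesgue measure, and the substitution
    rule is integration against an image measure. *)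
Definition affine_pullback (r c : R) (r0 : 0 < r) :
  {measure set measurableTypeR R -> \bar R}.
Proof.
refine (mscale (NngNum (ltW r0))
  (pushforward mu (fun x => r * x + c : measurableTypeR R))).
exact: measurable_affine.
Defined.

Lemma lebesgue_measure_affine (r c : R) (A : set R) (r0 : 0 < r) : measurable A ->
  affine_pullback c r0 A = mu A.
Proof.
move=> mA; apply/esym/lebesgue_measure_unique => //= _ [[a b]] _ <-.
rewrite /affine_pullback /= /mscale /= /pushforward.

rewrite (_ : _ @^-1` _ = `](a - c) / r, (b - c) / r]%classic); last first.
  apply/seteqP; split => x /=; rewrite !in_itv/= ltr_pdivrMr// ler_pdivlMr//;
    by rewrite ltrBlDr lerBrDr (mulrC x).
rewrite !lebesgue_measure_itv/= !lte_fin ltr_pM2r ?invr_gt0// ltrD2r.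
case: ifPn => _; rewrite ?mule0// -!EFinB -EFinM; congr EFin.
by field; rewrite gt_eqF.
Qed.

Lemma ge0_integral_affine (r c : R) (f : R -> \bar R) : 0 < r ->
  measurable_fun [set: R] f -> (forall x, 0 <= f x)%E ->
  (\int[mu]_x f x = r%:E * \int[mu]_x f (r * x + c)%R)%E.
Proof.
move=> r0 mf f0.
transitivity (\int[affine_pullback c r0]_x f x)%E.
  by apply: eq_measure_integral => A mA _; rewrite (lebesgue_measure_affine c r0).
rewrite /affine_pullback ge0_integral_mscale//.
rewrite (ge0_integral_pushforward (measurable_affine r c) mu)//.
Qed.

Lemma ge0_integral_oppr (f : R -> \bar R) :
  measurable_fun [set: R] f -> (forall x, 0 <= f x)%E ->
  (\int[mu]_x f x = \int[mu]_x f (- x)%R)%E.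
Proof.
move=> mf f0.
transitivity (\int[pushforward mu (-%R : _ -> measurableTypeR R)]_x f x)%E.
  by apply: eq_measure_integral => A mA _; exact/esym/lebesgue_measureN.
by rewrite ge0_integral_pushforward.
Qed.

(** Integrability is not assumed: since [r > 0], a part with infinite integral keeps an infinite
    integral after substitution, and then both sides are [0]. *)
Lemma Rintegral_affine (r c : R) (f : R -> R) : 0 < r -> measurable_fun [set: R] f ->
  \int[mu]_x f x = r * \int[mu]_x f (r * x + c).
Proof.
move=> r0 mf; pose g x := (f x)%:E.
have mg : measurable_fun [set: R] g by exact/measurable_EFinP.
rewrite /Rintegral [X in fine X = _]integralE [X in _ = _ * fine X]integralE.
have -> : (\int[mu]_x (fun x => (f (r * x + c))%:E)^\+ x =
    \int[mu]_x g^\+ (r * x + c)%R)%E.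
  by apply: eq_integral => x _; rewrite !funeposE.
have -> : (\int[mu]_x (fun x => (f (r * x + c))%:E)^\- x =
    \int[mu]_x g^\- (r * x + c)%R)%E.
  by apply: eq_integral => x _; rewrite !funenegE.
rewrite (ge0_integral_affine c r0 (measurable_funepos mg))//.
rewrite (ge0_integral_affine c r0 (measurable_funeneg mg))//.
have := @integral_ge0 _ _ _ mu setT _ (fun x _ => funepos_ge0 g (r * x + c)).
have := @integral_ge0 _ _ _ mu setT _ (fun x _ => funeneg_ge0 g (r * x + c)).
move: (\int[mu]_x g^\+ _)%E (\int[mu]_x g^\- _)%E.
move=> [p||] [q||]//= _ _; rewrite ?gt0_muley ?lte_fin//= ?mulr0// -mulrBr//.
Qed.

End lebesgue_change_of_variables.

(** * Continuity of translations in L^2 *)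

Lemma cvge0_near_lt (R : realType) (u : (\bar R)^nat) (e : R) :
  u n @[n --> \oo] --> 0%E -> 0 < e -> \forall n \near \oo, (u n < e%:E)%E.
Proof.
move=> /fine_cvgP[ufin /cvgrPdist_lt/(_ e) ue] /ue {}ue.
near=> n; have nfin : u n \is a fin_num by near: n.
rewrite -(fineK nfin) lte_fin (le_lt_trans (ler_norm _))//.
by rewrite -normrN -[- _]add0r; near: n.
Unshelve. all: by end_near. Qed.

Lemma near_lt_cvge0 (R : realType) (u : (\bar R)^nat) : (forall n, 0 <= u n)%E ->
  (forall e : R, 0 < e -> \forall n \near \oo, (u n < e%:E)%E) ->
  u n @[n --> \oo] --> 0%E.
Proof.
move=> u0 ue; apply/fine_cvgP; split.
  by near=> n; rewrite ge0_fin_numE// (lt_trans _ (ltry 1))//; near: n; exact: ue.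
apply/cvgrPdist_lt => e e0; near=> n.
rewrite sub0r normrN ger0_norm ?fine_ge0// -lte_fin fineK; first by near: n; exact: ue.
by rewrite ge0_fin_numE// (lt_trans _ (ltry 1))//; near: n; exact: ue.
Unshelve. all: by end_near. Qed.

Section L2_translation.
Variable R : realType.
Notation mu := (@lebesgue_measure R).
Implicit Types f g h : R -> R.

Let sqint f := (\int[mu]_x (f x ^+ 2)%:E)%E.

Let sqint_ge0 f : (0 <= sqint f)%E.
Proof. by apply: integral_ge0 => x _; rewrite lee_fin sqr_ge0. Qed.

Lemma measurable_sqr d (T : measurableType d) (f : T -> R) :
  measurable_fun [set: T] f -> measurable_fun [set: T] (fun x => (f x ^+ 2)%:E).
Proof. by move=> mf; exact/measurable_EFinP/measurable_funX. Qed.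

Lemma measurable_translate f c : measurable_fun [set: R] f ->
  measurable_fun [set: R] (fun x => f (x + c)).
Proof. by move=> mf; apply: measurableT_comp => //; exact: measurable_funD. Qed.

Lemma sqint_translate f c : measurable_fun [set: R] f ->
  (\int[mu]_x (f (x + c) ^+ 2)%:E = \int[mu]_x (f x ^+ 2)%:E)%E.
Proof.
move=> mf; rewrite [RHS](ge0_integral_affine c ltr01); last 2 first.
- exact: measurable_sqr.
- by move=> x; rewrite lee_fin sqr_ge0.
by rewrite mul1e; under [RHS]eq_integral do rewrite mul1r.
Qed.

(** Stands in for the triangle inequality of the $L^2$ norm, by $(x+y+z)^2 \le 3(x^2+y^2+z^2)$. *)
Let sqint_le3 f g1 g2 g3 : measurable_fun [set: R] f -> measurable_fun [set: R] g1 ->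
  measurable_fun [set: R] g2 -> measurable_fun [set: R] g3 ->
  (forall x, f x = g1 x + g2 x + g3 x) ->
  (sqint f <= 3%:E * (sqint g1 + sqint g2 + sqint g3))%E.
Proof.
move=> mf m1 m2 m3 fE.
rewrite -!ge0_integralD//; try (by move=> *; rewrite ?adde_ge0// lee_fin sqr_ge0);
  try exact: measurable_sqr; last first.
  by apply: emeasurable_funD; exact: measurable_sqr.
have mS : measurable_fun [set: R]
    (fun x => (g1 x ^+ 2)%:E + (g2 x ^+ 2)%:E + (g3 x ^+ 2)%:E)%E.
  by do 2 (apply: emeasurable_funD; last exact: measurable_sqr); exact: measurable_sqr.
rewrite -ge0_integralZl//; last by move=> *; rewrite ?adde_ge0// lee_fin sqr_ge0.
apply: ge0_le_integral => //.
- by move=> x _; rewrite lee_fin sqr_ge0.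
- exact: measurable_sqr.
- exact: measurable_funeM.
move=> x _; rewrite -!EFinD -EFinM lee_fin fE.
have := sqr_ge0 (g1 x - g2 x); have := sqr_ge0 (g1 x - g3 x).
by have := sqr_ge0 (g2 x - g3 x); nra.
Qed.

(** Continuity of translations along sequences, the form in which dominated convergence applies. *)
Let L2_continuous_at0 g := forall s : nat -> R, s n @[n --> \oo] --> 0 ->
  sqint (fun x => g x - g (x + s n)) @[n --> \oo] --> 0%E.

(** Split $f(x)-f(x+s)$ as $(f-g)(x) + (g(x)-g(x+s)) + (g-f)(x+s)$. Translation invariance gives the
    outer two terms the same norm, and the middle one is small by hypothesis on [g]. *)
Let L2_continuous_at0_approx f : measurable_fun [set: R] f ->
  (forall e : R, 0 < e -> exists g, [/\ measurable_fun [set: R] g,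
     (sqint (fun x => (f x - g x)%R) < e%:E)%E & L2_continuous_at0 g]) ->
  L2_continuous_at0 f.
Proof.
move=> mf approx s s0; apply: near_lt_cvge0 => // e e0.
(* Three terms, each multiplied by the factor [3] of [sqint_le3]. *)
have e9 : 0 < e / 9 by rewrite divr_gt0.
have [g [mg fg gc]] := approx _ e9.
near=> n.
have ms h : measurable_fun [set: R] h -> measurable_fun [set: R] (fun x => h (x + s n)).
  exact: measurable_translate.
apply: le_lt_trans (sqint_le3 (g1 := fun x => f x - g x)
  (g2 := fun x => g x - g (x + s n)) (g3 := fun x => g (x + s n) - f (x + s n))
  _ _ _ _ _) _; [by apply: measurable_funB => //; exact: ms..|by move=> x; ring|].
have -> : sqint (fun x => g (x + s n) - f (x + s n)) = sqint (fun x => f x - g x).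
  rewrite /sqint -(@sqint_translate (fun x => f x - g x) (s n)); last first.
    exact: measurable_funB.
  by apply: eq_integral => x _; rewrite -sqrrN opprB.
have -> : (e%:E = 3%:E * ((e / 9)%:E + (e / 9)%:E + (e / 9)%:E))%E.
  by rewrite -!EFinD -EFinM; congr EFin; field.
rewrite lte_pmul2l// !lteD//.
by near: n; apply: cvge0_near_lt => //; exact: gc.
Unshelve. all: by end_near. Qed.

(** For [0 <= N] this is the truncation of [y] to $[-N,N]$. Written with absolute values, it is
    continuous and 1-Lipschitz by the properties of the norm, without case analysis. *)
Let clamp (N y : R) : R := (`|y + N| - `|y - N|) / 2.

Let clamp_id (N y : R) : `|y| <= N -> clamp N y = y.
Proof.
rewrite ler_norml => /andP[Ny yN]; rewrite /clamp ger0_norm; last lra.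
by rewrite ler0_norm; [field|lra].
Qed.

Let clamp_lipschitz (N y z : R) : `|clamp N y - clamp N z| <= `|y - z|.
Proof.
rewrite /clamp ler_norml.
have := ler_normD (y + N) (z - y); have := ler_normD (z + N) (y - z).
have := ler_normD (y - N) (z - y); have := ler_normD (z - N) (y - z).
rewrite (distrC z y) (_ : y - N + (z - y) = z - N); last ring.
rewrite (_ : z - N + (y - z) = y - N); last ring.
rewrite (_ : y + N + (z - y) = z + N); last ring.
rewrite (_ : z + N + (y - z) = y + N); last ring.
by move=> *; apply/andP; split; lra.
Qed.

Let clamp_le (N y : R) : 0 <= N -> `|clamp N y| <= N.
Proof.
move=> N0; rewrite /clamp ler_norml.
have := ler_normD (y + N) (- (N + N)); have := ler_normD (y - N) (N + N).
rewrite normrN (ger0_norm (addr_ge0 N0 N0)).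
rewrite (_ : y - N + (N + N) = y + N); last ring.
rewrite (_ : y + N - (N + N) = y - N); last ring.
by move=> *; apply/andP; split; lra.
Qed.

Let clamp_continuous (N : R) : continuous (clamp N).
Proof.
move=> y; apply: cvgM; last exact: cvg_cst.
apply: cvgB; apply: cvg_norm.
  by apply: cvgD; [exact: cvg_id|exact: cvg_cst].
by apply: cvgB; [exact: cvg_id|exact: cvg_cst].
Qed.

(** Bounded and supported in $[-N,N]$. For continuous [c] the jumps at $\pm N$ are allowed, because
    two points form a null set. *)
Let cutoff (N : R) (c : R -> R) (x : R) : R := if `|x| <= N then clamp N (c x) else 0.

Let measurable_cutoff (N : R) (c : R -> R) : continuous c ->
  measurable_fun [set: R] (cutoff N c).
Proof.
move=> cc; apply: measurable_fun_if => //.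
- by apply: measurable_fun_ler => //; exact: measurableT_comp.
- apply: measurable_funTS; apply: continuous_measurable_fun => x.
  by apply: continuous_comp; [exact: cc|exact: clamp_continuous].
Qed.

Let cutoff_continuous (N : R) (c : R -> R) x : continuous c -> `|x| != N ->
  {for x, continuous (cutoff N c)}.
Proof.
move=> cc; have nx : `|y| @[y --> x] --> `|x| by apply: cvg_norm; exact: cvg_id.
rewrite neq_lt => /orP[] xN.
- have ccc : {for x, continuous (clamp N \o c)}.
    by apply: continuous_comp; [exact: cc|exact: clamp_continuous].
  rewrite /prop_for /continuous_at /cutoff (ltW xN).
  apply: cvg_trans ccc; apply: near_eq_cvg; near=> y.
  have -> // : `|y| <= N.
  by apply: ltW; near: y; exact: (cvgr_lt _ nx).
- rewrite /prop_for /continuous_at /cutoff [`|x| <= N]leNgt xN/=.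
  have c0 : cst (0 : R) y @[y --> x] --> (0 : R) by exact: cvg_cst.
  apply: cvg_trans c0; apply: near_eq_cvg; near=> y.
  rewrite leNgt; have -> // : N < `|y|.
  by near: y; exact: (cvgr_gt _ nx).
Unshelve. all: by end_near. Qed.

Let cutoff_le (N : R) (c : R -> R) x : 0 <= N -> `|cutoff N c x| <= N.
Proof. by move=> N0; rewrite /cutoff; case: ifP => _; rewrite ?normr0// clamp_le. Qed.

Let cutoff_L2_continuous_at0 (N : R) (c : R -> R) : 0 <= N -> continuous c ->
  L2_continuous_at0 (cutoff N c).
Proof.
move=> N0 cc s s0.
have [B [_ /(_ (B + 1))]] : bounded_fun s.
  by apply: cvg_seq_bounded; apply: cvgP s0.
rewrite ltrDl ltr01 => /(_ isT) sB.
(* As [B + 1] bounds all [s n], both [g x] and [g (x + s n)] vanish when $|x| > K$. *)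
pose K := N + (B + 1); pose g := cutoff N c.
have mg : measurable_fun [set: R] g by exact: measurable_cutoff.
(* A difference of two values of [g] is at most [2 * N] in absolute value, whence the factor
   $(2N)^2$. *)
pose G x : R := 4 * N ^+ 2 * \1_`[- K, K] x.
have iG : mu.-integrable [set: R] (EFin \o G).
  apply: integrableT_scale; apply: (@integrable_indic_itv R (- K) K true false).

pose h n x := ((g x - g (x + s n)) ^+ 2)%:E.
have mh n : measurable_fun [set: R] (h n).
  by apply: measurable_sqr; apply: measurable_funB => //; exact: measurable_translate.
have h0 : {ae mu, forall x, setT x -> h n x @[n --> \oo] --> cst 0%E x}.
  exists [set N; - N]; split.
  - by apply: measurableU; exact: measurable_set1.
  - apply: countable_lebesgue_measure0; apply: finite_set_countable.
    by rewrite finite_setU; split; exact: finite_set1.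
  - move=> x /= xh; apply: contrapT => xN; apply: xh => _.
    have {}xN : `|x| != N.
      apply/eqP => xN'; apply: xN; have [x0|x0] := leP 0 x.
        by left; rewrite -xN' ger0_norm.
      by right; rewrite -xN' ltr0_norm// opprK.
    have gx : g (x + s n) @[n --> \oo] --> g x.
      have xs : x + s n @[n --> \oo] --> x.
        by rewrite -{2}(addr0 x); apply: cvgD => //; exact: cvg_cst.
      exact: cvg_comp xs (cutoff_continuous cc xN).
    apply/fine_cvgP; split; first by apply: nearW => n.
    have dx : g x - g (x + s n) @[n --> \oo] --> 0.
      by rewrite -(subrr (g x)); apply: cvgB => //; exact: cvg_cst.
    have dd := cvgM dx dx; rewrite mulr0 in dd; exact: dd.
have hG : {ae mu, forall x, forall n, setT x -> (`|h n x| <= (EFin \o G) x)%E}.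
  apply: aeW => x n _; rewrite /h/= lee_fin ger0_norm ?sqr_ge0// /G.
  rewrite indicE; case: (boolP (x \in _)) => [_|]; rewrite ?mulr1 ?mulr0.
    have := cutoff_le c x N0; have := cutoff_le c (x + s n) N0.
    rewrite -/g !ler_norml => /andP[? ?] /andP[? ?].
    rewrite -[X in _ <= X]/(4 * N ^+ 2).
    by nra.
  rewrite notin_setE/= in_itv/= => xK.
  have {}xK : K < `|x|.
    by rewrite ltNge; apply/negP; rewrite ler_norml => /xK.
  have sn : `|s n| <= B + 1 by exact: sB.
  have B0 : 0 <= B + 1 by rewrite (le_trans _ sn).
  rewrite /g /cutoff ifF; last by apply/negbTE; rewrite -ltNge; rewrite /K in xK; lra.
  rewrite ifF ?subrr ?expr0n//; apply/negbTE; rewrite -ltNge.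
  have := ler_normB (x + s n) (s n); rewrite addrK; rewrite /K in xK; lra.
have m0 : measurable_fun [set: R] (cst 0%E : R -> \bar R) by exact: measurable_cst.
have [_ _] := @dominated_convergence _ _ _ mu setT measurableT h _ (EFin \o G) mh m0 h0 iG hG.
by rewrite integral0.
Qed.

Let cutoff_approx (N : R) f (e : R) : 0 < N -> measurable_fun [set: R] f ->
  (forall x, `|f x| <= N) -> (forall x, N < `|x| -> f x = 0) -> 0 < e ->
  exists2 c, continuous c & (sqint (fun x => (f x - cutoff N c x)%R) < e%:E)%E.
Proof.
move=> N0 mf fN f0 e0.
pose I : set R := `[- N, N]%classic.
have mI : measurable I by exact: measurable_itv.
have mufin : (mu I < +oo)%E.
  by rewrite /I lebesgue_measure_itv/=; case: ifP => _; rewrite ltry.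
have fi : mu.-integrable I (EFin \o f).
  apply: measurable_bounded_integrable => //; first exact: measurable_funTS.
  by exists N; split; rewrite ?num_real// => M NM x _; rewrite /= (le_trans (fN x))// ltW.
have [c_ [cc ci c0]] := approximation_continuous_integrable mI mufin fi.
(* Approximation by continuous functions is available in $L^1$. It passes to $L^2$ because [f] and
   the clamped approximation are bounded by [N] and clamping is 1-Lipschitz: on $[-N,N]$ the squared
   error is at most $2N\,|f-c_n|$. *)
have e2 : 0 < e / (2 * N) by rewrite divr_gt0 ?mulr_gt0.
have [n _ /(_ n (leqnn _)) /= cn] := cvge0_near_lt c0 e2.
exists (c_ n) => //.
have mcn : measurable_fun [set: R] (c_ n) by exact: continuous_measurable_fun.
have mc := measurable_cutoff N (cc n).
have mabs : measurable_fun I (fun x => `|(f x - c_ n x)%:E|)%E.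
  apply: measurable_funTS; apply/measurable_EFinP.
  by apply: measurableT_comp => //; exact: measurable_funB.
apply: (@le_lt_trans _ _ (\int[mu]_(x in I) ((2 * N)%:E * `|(f x - c_ n x)%:E|))%E);
  last first.
  rewrite ge0_integralZl//; last by rewrite lee_fin mulr_ge0// ltW.
  by rewrite -lte_pdivlMl ?mulr_gt0// muleC.
rewrite [X in (_ <= X)%E]integral_mkcond; apply: ge0_le_integral => //.
- by move=> x _; rewrite lee_fin sqr_ge0.
- by apply: measurable_sqr; exact: measurable_funB.
- by apply/(measurable_restrictT _ mI); exact: measurable_funeM.
move=> x _; rewrite patchE; case: ifPn => [|].
  rewrite inE/I/= in_itv/= -ler_norml => xN.
  rewrite -EFinM lee_fin /cutoff xN.
  have := clamp_lipschitz N (f x) (c_ n x); rewrite (clamp_id (fN x)).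
  have := ler_normB (f x) (clamp N (c_ n x)).
  have := fN x; have := clamp_le (c_ n x) (ltW N0).
  rewrite -real_normK ?num_real//.
  have := normr_ge0 (f x - clamp N (c_ n x)).
  have := normr_ge0 (f x - (c_ n x)); nra.
rewrite notin_setE/I/= in_itv/= -ler_norml => xN.
have {}xN : N < `|x| by rewrite ltNge; exact/negP.
by rewrite /cutoff [`|x| <= N]leNgt xN/= f0// subrr expr0n.
Qed.

(** Cuts both the domain and the range, which gives the boundedness and bounded support that
    [cutoff_approx] asks for. The bound [n.+1] is positive for every [n]. *)
Let truncate (n : nat) f x : R :=
  if (`|x| <= n.+1%:R) && (`|f x| <= n.+1%:R) then f x else 0.

Let measurable_truncate n f : measurable_fun [set: R] f ->
  measurable_fun [set: R] (truncate n f).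
Proof.
move=> mf; apply: measurable_fun_if => //; last exact: measurable_funTS.
by apply: measurable_and; apply: measurable_fun_ler => //; exact: measurableT_comp.
Qed.

Let truncate_cvg f : measurable_fun [set: R] f -> (sqint f < +oo)%E ->
  sqint (fun x => f x - truncate n f x) @[n --> \oo] --> 0%E.
Proof.
move=> mf foo.
pose h n x := ((f x - truncate n f x) ^+ 2)%:E.
have mh n : measurable_fun [set: R] (h n).
  by apply: measurable_sqr; apply: measurable_funB => //; exact: measurable_truncate.
have h0 : {ae mu, forall x, setT x -> h n x @[n --> \oo] --> cst 0%E x}.
  apply: aeW => x _; apply: cvg_near_cst.
  near=> n; rewrite /h /truncate ifT ?subrr ?expr0n//.
  apply/andP; split; apply: ltW; rewrite (@lt_trans _ _ n%:R) ?ltr_nat//; near: n;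
    exact: nbhs_infty_gtr.
have fi : mu.-integrable [set: R] (EFin \o (fun x => f x ^+ 2)).
  by apply: ge0_integrableT_lty => // [|x]; [exact: measurable_funX|exact: sqr_ge0].
have hf : {ae mu, forall x, forall n, setT x ->
    (`|h n x| <= (EFin \o (fun x => f x ^+ 2)%R) x)%E}.
  apply: aeW => x n _; rewrite /h/= lee_fin ger0_norm ?sqr_ge0// /truncate.
  by case: ifP => _; rewrite ?subr0// subrr expr0n sqr_ge0.
have m0 : measurable_fun [set: R] (cst 0%E : R -> \bar R) by exact: measurable_cst.
have [_ _] := @dominated_convergence _ _ _ mu setT measurableT h _ _ mh m0 h0 fi hf.
by rewrite integral0.
Unshelve. all: by end_near. Qed.

Theorem L2_translation_cvg0 f (s : nat -> R) : measurable_fun [set: R] f ->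
  (\int[mu]_x (f x ^+ 2)%:E < +oo)%E -> s n @[n --> \oo] --> 0 ->
  (\int[mu]_x ((f x - f (x + s n)) ^+ 2)%:E)%E @[n --> \oo] --> 0%E.
Proof.
move=> mf foo; apply: L2_continuous_at0_approx => // e e0.
have e9 : 0 < e / 9 by rewrite divr_gt0.
have [n _ /(_ n (leqnn _)) /= fn] := cvge0_near_lt (truncate_cvg mf foo) e9.
have mt := measurable_truncate n mf.
have [||c cc fc] := cutoff_approx (ltr0Sn R n) mt _ _ e9.
- by move=> x; rewrite /truncate; case: ifP => [/andP[]//|_]; rewrite normr0.
- by move=> x nx; rewrite /truncate leNgt nx.
have mc := measurable_cutoff n.+1%:R cc.
exists (cutoff n.+1%:R c); split => //; last exact: cutoff_L2_continuous_at0.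
(* Only two errors occur here, truncation and cutoff; the third summand is [0]. *)
apply: le_lt_trans (sqint_le3 (g1 := fun x => f x - truncate n f x)
  (g2 := fun x => truncate n f x - cutoff n.+1%:R c x) (g3 := fun=> 0)
  _ _ _ _ _) _; [by apply: measurable_funB..|exact: measurable_cst|by move=> x; ring|].
have -> : sqint (fun=> 0) = 0%E.
  by rewrite /sqint; under eq_integral do rewrite expr0n; rewrite integral0.
have -> : (e%:E = 3%:E * ((e / 9)%:E + (e / 9)%:E + (e / 9)%:E))%E.
  by rewrite -!EFinD -EFinM; congr EFin; field.
by rewrite lte_pmul2l// !lteD// lte_fin.
Qed.

Lemma autocorrelation_cvg f (s : nat -> R) : measurable_fun [set: R] f ->
  mu.-integrable [set: R] (EFin \o (fun x => f x ^+ 2)) -> s n @[n --> \oo] --> 0 ->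
  \int[mu]_x (f x * f (x + s n)) @[n --> \oo] --> \int[mu]_x f x ^+ 2.
Proof.
move=> mf fi s0; have foo := integrable_lty measurableT fi.
have mt n := measurable_translate (s n) mf.
have ti n : mu.-integrable [set: R] (EFin \o (fun x => f (x + s n) ^+ 2)).
  apply: ge0_integrableT_lty => [|x|]; [|exact: sqr_ge0|].
    by apply: measurable_funX; exact: mt.
  by rewrite sqint_translate.
have di n : mu.-integrable [set: R] (EFin \o (fun x => (f x - f (x + s n)) ^+ 2)).
  apply: integrable_le_norm (integrableT_scale 2 (integrableT_add fi (ti n))) _.
    by apply: measurable_funX; apply: measurable_funB => //; exact: mt.
  move=> x; rewrite ger0_norm ?sqr_ge0//.
  by have := sqr_ge0 (f x + f (x + s n)); nra.
have tE n : \int[mu]_x f (x + s n) ^+ 2 = \int[mu]_x f x ^+ 2.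
  by rewrite /Rintegral; congr fine; exact: sqint_translate.
(* By $xy = (x^2+y^2)/2 - (x-y)^2/2$ and translation invariance of the norm, the deviation of the
   autocorrelation from its value at [0] is half the squared distance from [f] to its translate. *)
have -> : (fun n => \int[mu]_x (f x * f (x + s n))) =
    (fun n => \int[mu]_x f x ^+ 2 - 2^-1 * \int[mu]_x (f x - f (x + s n)) ^+ 2).
  apply/funext => n.
  under eq_Rintegral => x _.
    rewrite (_ : f x * _ = 2^-1 * (f x ^+ 2 + f (x + s n) ^+ 2) -
      2^-1 * (f x - f (x + s n)) ^+ 2); last by field.
    over.
  rewrite RintegralB//; last 2 first.
    exact/integrableT_scale/integrableT_add.
    exact: integrableT_scale.
  rewrite !RintegralZl//; last exact: integrableT_add.
  by rewrite RintegralD// tE; field.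
rewrite -[X in _ --> X]subr0 -[X in _ - X](mulr0 (2^-1 : R)).
apply: cvgB; first exact: cvg_cst.
apply: cvgM; first exact: cvg_cst.
exact: fine_cvg (L2_translation_cvg0 mf foo s0).
Qed.

End L2_translation.

(** * The Poisson kernel *)

Lemma continuous_cosM (R : realType) (s : R) : continuous (fun u : R => cos (s * u)).
Proof.
move=> u; apply: continuous_comp; last exact: continuous_cos.
by apply: cvgM; [exact: cvg_cst|exact: cvg_id].
Qed.

Section poisson_kernel.
Variable R : realType.
Notation mu := (@lebesgue_measure R).

Section half_line.
Variables e s : R.
Hypothesis e0 : 0 < e.

Let A := (e ^+ 2 + s ^+ 2)^-1.

Let Aneq0 : e ^+ 2 + s ^+ 2 != 0.
Proof. by rewrite gt_eqF// ltr_pwDl ?exprn_gt0// sqr_ge0. Qed.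

(** The summand [1] makes the integrand nonnegative, so that the fundamental theorem of calculus on
    a half-line applies without prior integrability. It is removed in [Rintegral_expR_norm_cos]. *)
Let f (u : R) := expR (- (e * u)) * (1 + cos (s * u)).

(** The first term comes from the antiderivative of $e^{-eu}\cos(su)$, the second from that of
    $e^{-eu}$, with the common exponential left to [F]. *)
Let G (u : R) := A * (s * sin (s * u) - e * cos (s * u)) - e^-1.

Let F (u : R) := expR (- (e * u)) * G u.

Let is_deriveF (u : R) : is_derive u 1 F (f u).
Proof.
have dl (c : R) : is_derive u 1 (fun x : R => c * x) c.
  by apply: is_derive_eq; rewrite /GRing.scale/= mulr1.
have dN : is_derive u 1 (fun x : R => - (e * x)) (- e).
  by have := dl e => de; apply: is_derive_eq.
have dE : is_derive u 1 (fun x : R => expR (- (e * x))) (expR (- (e * u)) * - e).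
  exact: (is_derive1_comp (is_derive_expR _) dN).
have dS : is_derive u 1 (fun x : R => sin (s * x)) (cos (s * u) * s).
  exact: (is_derive1_comp (is_derive_sin _) (dl s)).
have dC : is_derive u 1 (fun x : R => cos (s * x)) (- sin (s * u) * s).
  exact: (is_derive1_comp (is_derive_cos _) (dl s)).
have dG : is_derive u 1 G (A * (s * (cos (s * u) * s) - e * (- sin (s * u) * s))).
  by apply: is_derive_eq; rewrite /GRing.scale/= subr0.
have dF : is_derive u 1 F (expR (- (e * u)) * (A * (s * (cos (s * u) * s) -
    e * (- sin (s * u) * s))) + G u * (expR (- (e * u)) * - e)).
  exact: (is_deriveM dE dG).
apply: is_derive_eq; rewrite /f /G /A; field.
by rewrite Aneq0 gt_eqF.
Qed.

Let F_cvg0 : F u @[u --> +oo] --> 0.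
Proof.
pose K := A * (`|s| + e) + e^-1.
have K0 : 0 <= K.
  by rewrite addr_ge0 ?invr_ge0 ?(ltW e0)// mulr_ge0 ?addr_ge0 ?(ltW e0)//
    invr_ge0 addr_ge0 ?sqr_ge0.
have GK u : `|G u| <= K.
  rewrite /G (le_trans (ler_normB _ _))// lerD//; last by rewrite ger0_norm// invr_ge0 ltW.
  rewrite normrM (ger0_norm (_ : 0 <= A)); last by rewrite invr_ge0 addr_ge0 ?sqr_ge0.
  rewrite ler_wpM2l ?invr_ge0 ?addr_ge0 ?sqr_ge0// (le_trans (ler_normB _ _))//.
  rewrite lerD// normrM.
    by rewrite -[leRHS]mulr1 ler_wpM2l// ler_norml sin_geN1 sin_le1.
  rewrite (ger0_norm (ltW e0)) -[leRHS]mulr1 ler_wpM2l ?(ltW e0)//.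
  by rewrite ler_norml cos_geN1 cos_le1.
have E0 : K * expR (- (e * u)) @[u --> +oo] --> 0.
  rewrite -[X in _ --> X](mulr0 K); apply: cvgM; first exact: cvg_cst.
  have eu : e * u @[u --> +oo] --> +oo by apply: (gt0_cvgMry e0); exact: cvg_id.
  exact: (@cvg_comp _ _ _ (fun u => e * u) (fun x => expR (- x)) _ _ _ eu (@cvgr_expR R)).
apply/norm_cvg0P.
apply: (@squeeze_cvgr _ _ _ _ (cst 0) (fun u => K * expR (- (e * u)))) => //.
  apply: nearW => u; rewrite normr_ge0/= /F normrM (ger0_norm (expR_ge0 _)).
  by rewrite mulrC ler_wpM2r ?expR_ge0.
exact: cvg_cst.
Qed.

Let f_continuous : continuous f.
Proof.
move=> u; apply: cvgM.
  apply: (@continuous_comp _ _ _ (fun x => - (e * x)) expR); last exact: continuous_expR.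
  by apply: cvgN; apply: cvgM; [exact: cvg_cst|exact: cvg_id].
apply: cvgD; [exact: cvg_cst|exact: continuous_cosM].
Qed.

Let f_ge0 u : 0 <= f u.
Proof. by rewrite mulr_ge0 ?expR_ge0// -lerBlDl sub0r cos_geN1. Qed.

Lemma integral_expR_1Dcos :
  (\int[mu]_(u in `[0%R, +oo[) (expR (- (e * u)) * (1 + cos (s * u)))%:E =
   (e^-1 + e / (e ^+ 2 + s ^+ 2))%:E)%E.
Proof.
rewrite (@ge0_continuous_FTC2y _ f F 0 0) //.
- rewrite -EFinB; congr EFin; rewrite /F /G !mulr0 oppr0 sin0 cos0 expR0 /A; field.
  by rewrite Aneq0 gt_eqF.
- exact: continuous_subspaceT.
- apply: cvg_at_right_filter; apply: differentiable_continuous; apply/derivable1_diffP.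
  by have [] := is_deriveF 0.
- by move=> x _; rewrite derive1E; have [] := is_deriveF x.
Qed.

Lemma integral_expR_norm_1Dcos :
  (\int[mu]_u (expR (- (e * `|u|)) * (1 + cos (s * u)))%:E =
   (2 * (e^-1 + e / (e ^+ 2 + s ^+ 2)))%:E)%E.
Proof.
rewrite (@ge0_symfun_integralT _ (fun u => expR (- (e * `|u|)) * (1 + cos (s * u)))).
- rewrite EFinM -integral_expR_1Dcos set_itvcy; congr (_ * _)%E.
  by apply: eq_integral => x; rewrite inE/= => x0; rewrite ger0_norm.
- by move=> u; rewrite mulr_ge0 ?expR_ge0// -lerBlDl sub0r cos_geN1.
- move=> u; apply: cvgM.
    apply: (@continuous_comp _ _ _ (fun x => - (e * `|x|)) expR); last exact: continuous_expR.
    by apply: cvgN; apply: cvgM; [exact: cvg_cst|apply: cvg_norm; exact: cvg_id].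
  apply: cvgD; [exact: cvg_cst|exact: continuous_cosM].
- by move=> u /=; rewrite normrN mulrN cosN.
Qed.

End half_line.

Lemma measurable_expR_norm (e : R) :
  measurable_fun [set: R] (fun u : R => expR (- (e * `|u|))).
Proof.
apply: measurableT_comp => //; apply: measurable_funN; apply: measurable_funM => //.
Qed.

Lemma integrable_expR_norm (e : R) : 0 < e ->
  mu.-integrable [set: R] (EFin \o (fun u : R => expR (- (e * `|u|)))).
Proof.
move=> e0; apply: ge0_integrableT_lty => [|u|].
- exact: measurable_expR_norm.
- exact: expR_ge0.
apply: (@le_lt_trans _ _ (\int[mu]_u (expR (- (e * `|u|)) * (1 + cos (0 * u)))%:E)%E);
  last by rewrite integral_expR_norm_1Dcos// ltry.
apply: ge0_le_integral => //.
- by apply/measurable_EFinP; exact: measurable_expR_norm.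
- apply/measurable_EFinP; apply: measurable_funM; first exact: measurable_expR_norm.
  apply: measurable_funD => //; apply: continuous_measurable_fun; exact: continuous_cosM.
- by move=> x _; rewrite lee_fin mul0r cos0; have := expR_ge0 (- (e * `|x|)); lra.
Qed.

(** The Fourier transform of the weight is the Poisson kernel. At [s = 0] the cosine is [1], so the
    formula for [1 + cos] yields the integral of the weight alone, which is then subtracted. *)
Lemma Rintegral_expR_norm_cos (e s : R) : 0 < e ->
  \int[mu]_u (expR (- (e * `|u|)) * cos (s * u)) = 2 * e / (e ^+ 2 + s ^+ 2).
Proof.
move=> e0.
have solve_q (p q r t : R) : p + p = 2 * (r + r) -> p + q = 2 * (r + t) -> q = 2 * t.
  by move=> *; lra.
have ie := integrable_expR_norm e0.
have ic (t : R) : mu.-integrable [set: R]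
    (EFin \o (fun u => expR (- (e * `|u|)) * cos (t * u))).
  apply: (integrableT_bounded_mul ie (M := 1)).
    by apply: continuous_measurable_fun; exact: continuous_cosM.
  by move=> x; rewrite ler_norml cos_geN1 cos_le1.
have I (t : R) : \int[mu]_u (expR (- (e * `|u|))) +
    \int[mu]_u (expR (- (e * `|u|)) * cos (t * u)) =
    2 * (e^-1 + e / (e ^+ 2 + t ^+ 2)).
  rewrite -RintegralD//.
  under eq_Rintegral do rewrite -{1}[expR _]mulr1 -mulrDr.
  by rewrite /Rintegral integral_expR_norm_1Dcos.
have i0 : \int[mu]_u (expR (- (e * `|u|)) * cos (0 * u)) =
    \int[mu]_u (expR (- (e * `|u|))).
  by apply: eq_Rintegral => x _; rewrite mul0r cos0 mulr1.
have := I 0; have := I s; rewrite i0 expr0n addr0 => Is I0.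
have e2 : e / e ^+ 2 = e^-1 by field; rewrite gt_eqF.
by rewrite e2 in I0; rewrite (solve_q _ _ _ _ I0 Is) mulrA.
Qed.

(** The source of the constant in Plancherel's identity: [2 * atan] increases by $\pi$ on the
    half-line, and symmetry doubles this. *)
Lemma integral_cauchy : (\int[mu]_t (2 / (1 + t ^+ 2))%:E = (2 * pi)%:E)%E.
Proof.
have c2 : continuous (fun t : R => 2 / (1 + t ^+ 2)).
  move=> t; apply: cvgM; first exact: cvg_cst.
  apply: cvgV; first by rewrite gt_eqF// ltr_pwDl// sqr_ge0.
  by apply: cvgD; [exact: cvg_cst|exact: exprn_continuous].
have p2 (t : R) : 0 <= 2 / (1 + t ^+ 2) by rewrite divr_ge0// addr_ge0// sqr_ge0.
have dA (t : R) : is_derive t 1 (fun t => 2 * atan t) (2 / (1 + t ^+ 2)).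
  by apply: is_derive_eq; rewrite /GRing.scale/=.
rewrite (@ge0_symfun_integralT _ (fun t => 2 / (1 + t ^+ 2)))//; last first.
  by move=> t /=; rewrite sqrrN.
rewrite -set_itvcy (@ge0_continuous_FTC2y _ _ (fun t => 2 * atan t) 0 (2 * (pi / 2)))//.
- by rewrite atan0 mulr0 sube0 -EFinM; congr EFin; field.
- exact: continuous_subspaceT.
- by apply: cvgM; [exact: cvg_cst|exact: cvgy_atan].
- by apply: cvg_at_right_filter; apply: cvgM; [exact: cvg_cst|exact: continuous_atan].
- by move=> x _; rewrite derive1E; have [] := dA x.
Qed.

Lemma integrable_cauchy :
  mu.-integrable [set: R] (EFin \o (fun t : R => 2 / (1 + t ^+ 2))).
Proof.
apply: ge0_integrableT_lty => [|t|].
- apply: continuous_measurable_fun => t; apply: cvgM; first exact: cvg_cst.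
  apply: cvgV; first by rewrite gt_eqF// ltr_pwDl// sqr_ge0.
  by apply: cvgD; [exact: cvg_cst|exact: exprn_continuous].
- by rewrite divr_ge0// addr_ge0// sqr_ge0.
- by rewrite integral_cauchy ltry.
Qed.

End poisson_kernel.

(** * Plancherel's identity in dimension one *)

Lemma normr_cos_le1 (R : realType) (x : R) : `|cos x| <= 1.
Proof. by rewrite ler_norml cos_geN1 cos_le1. Qed.

Lemma normr_sin_le1 (R : realType) (x : R) : `|sin x| <= 1.
Proof. by rewrite ler_norml sin_geN1 sin_le1. Qed.

Section measurable_trigo.
Context d (T : measurableType d) (R : realType).
Variable f : T -> R.
Hypothesis mf : measurable_fun [set: T] f.

Lemma measurable_funcos : measurable_fun [set: T] (fun x => cos (f x)).
Proof.
apply: measurableT_comp => //; apply: continuous_measurable_fun.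
exact: continuous_cos.
Qed.

Lemma measurable_funsin : measurable_fun [set: T] (fun x => sin (f x)).
Proof.
apply: measurableT_comp => //; apply: continuous_measurable_fun.
exact: continuous_sin.
Qed.

End measurable_trigo.

(** * Cosine and sine transforms of an integrable function *)

Section cos_sin_transform.
Variable R : realType.
Notation mu := (@lebesgue_measure R).

(** With [sin_transform], the real part and the opposite of the imaginary part of $\int
    a(x)e^{-ixu}\,dx$. *)
Definition cos_transform (a : R -> R) (u : R) : R := \int[mu]_x (a x * cos (x * u)).
Definition sin_transform (a : R -> R) (u : R) : R := \int[mu]_x (a x * sin (x * u)).

Variable a : R -> R.
Hypothesis ia : mu.-integrable [set: R] (EFin \o a).

Let ma : measurable_fun [set: R] a := integrableT_measurable ia.

Lemma integrable_mul_cos u :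
  mu.-integrable [set: R] (EFin \o (fun x => a x * cos (x * u))).
Proof.
apply: (integrableT_bounded_mul ia) => [|x]; last exact: normr_cos_le1.
by apply: measurable_funcos; exact: measurable_funM.
Qed.

Lemma integrable_mul_sin u :
  mu.-integrable [set: R] (EFin \o (fun x => a x * sin (x * u))).
Proof.
apply: (integrableT_bounded_mul ia) => [|x]; last exact: normr_sin_le1.
by apply: measurable_funsin; exact: measurable_funM.
Qed.

Lemma measurable_cos_transform : measurable_fun [set: R] (cos_transform a).
Proof.
apply: (@measurable_Rintegral2 _ _ _ _ R mu (fun z => a z.2 * cos (z.2 * z.1))).
apply: measurable_funM; first exact: measurableT_comp.
by apply: measurable_funcos; exact: measurable_funM.
Qed.

Lemma measurable_sin_transform : measurable_fun [set: R] (sin_transform a).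
Proof.
apply: (@measurable_Rintegral2 _ _ _ _ R mu (fun z => a z.2 * sin (z.2 * z.1))).
apply: measurable_funM; first exact: measurableT_comp.
by apply: measurable_funsin; exact: measurable_funM.
Qed.

Lemma normr_Rintegral_mul_le (h : R -> R) : measurable_fun [set: R] h ->
  (forall x, `|h x| <= 1) -> `|\int[mu]_x (a x * h x)| <= \int[mu]_x `|a x|.
Proof.
move=> mh h1; have iah := integrableT_bounded_mul ia mh h1.
apply: le_trans (le_normr_Rintegral measurableT iah) _.
apply: le_Rintegral => //; [exact: integrable_norm|exact: integrable_norm|].
by move=> x _; rewrite normrM -[leRHS]mulr1 ler_wpM2l.
Qed.

Lemma cos_transformB x u :
  \int[mu]_y (a y * cos ((x - y) * u)) =
  cos (x * u) * cos_transform a u + sin (x * u) * sin_transform a u.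
Proof.
rewrite -!RintegralZl//; [|exact: integrable_mul_sin|exact: integrable_mul_cos].
rewrite -RintegralD//; last 2 first.
  exact/integrableT_scale/integrable_mul_cos.
  exact/integrableT_scale/integrable_mul_sin.
by apply: eq_Rintegral => y _; rewrite mulrBl cosB; ring.
Qed.

Let M := \int[mu]_x `|a x|.

(** The sum of squares is $\iint a(x)a(y)\cos((x-y)u)\,dx\,dy$ by the addition formula. Two
    applications of Fubini's theorem move the integral in [u] inside, where it becomes the cosine
    transform of the weight. *)
Lemma Rintegral_cos_sin_transform_sqr (w : R -> R) :
  mu.-integrable [set: R] (EFin \o w) ->
  \int[mu]_u (w u * (cos_transform a u ^+ 2 + sin_transform a u ^+ 2)) =
  \int[mu]_x (a x * \int[mu]_y (a y * \int[mu]_u (w u * cos ((x - y) * u)))).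
Proof.
move=> iw; have mw := integrableT_measurable iw.
have mC := measurable_cos_transform; have mS := measurable_sin_transform.
(* [H] is bounded by the $L^1$ norm of [a] uniformly in [x] and [u], so the product of the norms of
   [w] and [a] dominates the first interchange. *)
pose H x u := \int[mu]_y (a y * cos ((x - y) * u)).
have HM x u : `|H x u| <= M.
  apply: normr_Rintegral_mul_le => [|y]; last exact: normr_cos_le1.
  by apply: measurable_funcos; apply: measurable_funM => //; exact: measurable_funB.
have mH : measurable_fun [set: R * R] (fun z => H z.2 z.1).
  rewrite (_ : (fun z => _) = fun z : R * R => cos (z.2 * z.1) * cos_transform a z.1 +
    sin (z.2 * z.1) * sin_transform a z.1); last first.
    by apply/funext => z; exact: cos_transformB.
  apply: measurable_funD; apply: measurable_funM; try exact: measurableT_comp.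
    by apply: measurable_funcos; exact: measurable_funM.
  by apply: measurable_funsin; exact: measurable_funM.
have mHx x : measurable_fun [set: R] (H x).
  exact: (measurableT_comp mH (@measurable_pair2 _ _ _ _ x)).
have step1 u : w u * (cos_transform a u ^+ 2 + sin_transform a u ^+ 2) =
    \int[mu]_x (w u * (a x * H x u)).
  rewrite RintegralZl//; last first.
    apply: (integrableT_bounded_mul ia (M := M)) => //.
    exact: (measurableT_comp mH (@measurable_pair1 _ _ _ _ u)).
  congr (_ * _).
  under [RHS]eq_Rintegral do rewrite /H cos_transformB.
  under [RHS]eq_Rintegral => x _.
    rewrite (_ : a x * _ = cos_transform a u * (a x * cos (x * u)) +
      sin_transform a u * (a x * sin (x * u))); last by ring.
    over.
  rewrite RintegralD//; [|exact/integrableT_scale/integrable_mul_cos|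
    exact/integrableT_scale/integrable_mul_sin].
  by rewrite !RintegralZl//; [exact: integrable_mul_sin|exact: integrable_mul_cos].
under eq_Rintegral do rewrite step1.
rewrite (@Rintegral_fubini _ _ _ _ R mu mu (fun z => w z.1 * (a z.2 * H z.2 z.1))); last first.
  apply: (integrable_prod_mul _ (integrable_norm iw)
    (integrableT_scale M (integrable_norm ia))) => [|u x].
    apply: measurable_funM; first exact: measurableT_comp.
    by apply: measurable_funM => //; exact: measurableT_comp.
  by rewrite /= !normrM ler_wpM2l// mulrC ler_wpM2r.
apply: eq_Rintegral => x _ /=.
transitivity (a x * \int[mu]_u (w u * H x u)).
  have wHi := integrableT_bounded_mul iw (mHx x) (HM x).
  by rewrite -(RintegralZl (a x) measurableT wHi); apply: eq_Rintegral => u _; rewrite mulrCA.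
congr (a x * _).
rewrite /H; under eq_Rintegral => u _.
  rewrite -(@RintegralZl _ _ _ mu setT (fun y => a y * cos ((x - y) * u)) (w u))//;
    last first.
    apply: (integrableT_bounded_mul ia (M := 1)) => [|y]; last exact: normr_cos_le1.
    by apply: measurable_funcos; apply: measurable_funM => //; exact: measurable_funB.
  over.
rewrite (@Rintegral_fubini _ _ _ _ R mu mu (fun z => w z.1 * (a z.2 * cos ((x - z.2) * z.1))));
  last first.
  apply: (integrable_prod_mul _ (integrable_norm iw) (integrable_norm ia)) => [|u y].
    apply: measurable_funM; first exact: measurableT_comp.
    apply: measurable_funM; first exact: measurableT_comp.
    by apply: measurable_funcos; apply: measurable_funM => //; exact: measurable_funB.
  by rewrite /= !normrM ler_wpM2l// -[leRHS]mulr1 ler_wpM2l// normr_cos_le1.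
apply: eq_Rintegral => y _ /=.
under eq_Rintegral do rewrite mulrCA.
rewrite (@RintegralZl _ _ _ mu setT (fun u => w u * cos ((x - y) * u)) (a y))//.
apply: (integrableT_bounded_mul iw (M := 1)) => [|u]; last exact: normr_cos_le1.
by apply: measurable_funcos; exact: measurable_funM.
Qed.

End cos_sin_transform.

Lemma integrable_affine (R : realType) (f : R -> R) (r c : R) : 0 < r ->
  (@lebesgue_measure R).-integrable [set: R] (EFin \o f) ->
  (@lebesgue_measure R).-integrable [set: R] (EFin \o (fun x => f (r * x + c))).
Proof.
move=> r0 fi; have mf := integrableT_measurable fi.
apply: integrableT_norm_lty.
  by apply: measurableT_comp => //; exact: measurable_affine.
have foo := integrable_lty measurableT (integrable_norm fi).
have mn : measurable_fun [set: R] (fun x => `|f x|%:E).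
  by apply/measurable_EFinP; exact: measurableT_comp.
have n0 x : (0 <= `|f x|%:E)%E by rewrite lee_fin.
rewrite (ge0_integral_affine c r0 mn n0) in foo.
rewrite ltey; apply/negP => /eqP foo'.
by rewrite foo' gt0_muley ?lte_fin// in foo.
Qed.

(** * Plancherel's identity for one real function *)

Section plancherel1.
Variable R : realType.
Notation mu := (@lebesgue_measure R).

Section one_function.
Variable a : R -> R.
Hypothesis ia : mu.-integrable [set: R] (EFin \o a).
Hypothesis ia2 : mu.-integrable [set: R] (EFin \o (fun x => a x ^+ 2)).

Let ma : measurable_fun [set: R] a := integrableT_measurable ia.

Let A := \int[mu]_x a x ^+ 2.

(** The autocorrelation of [a]; [Phi 0] is [A]. *)
Let Phi s := \int[mu]_x (a x * a (x + s)).

Let P (t : R) := 2 / (1 + t ^+ 2).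

Let P_ge0 t : 0 <= P t. Proof. by rewrite divr_ge0// addr_ge0// sqr_ge0. Qed.

Let mP : measurable_fun [set: R] P := integrableT_measurable (@integrable_cauchy R).

Let P_le2 t : `|P t| <= 2.
Proof.
rewrite ger0_norm// ler_pdivrMr ?ltr_pwDl ?sqr_ge0//.
by have := sqr_ge0 t; nra.
Qed.

Let translate_sqr_integrable s :
  mu.-integrable [set: R] (EFin \o (fun x => a (x + s) ^+ 2)).
Proof.
apply: ge0_integrableT_lty => [|x|]; [|exact: sqr_ge0|].
  by apply: measurable_funX; exact: measurable_translate.
by rewrite sqint_translate// integrable_lty.
Qed.

Let mul_translate_integrable s :
  mu.-integrable [set: R] (EFin \o (fun x => a x * a (x + s))).
Proof. by apply: integrableT_mul => //; exact: measurable_translate. Qed.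

Let norm_mul_translate_le s : \int[mu]_x `|a x * a (x + s)| <= A.
Proof.
have -> : A = \int[mu]_x (2^-1 * (a x ^+ 2 + a (x + s) ^+ 2)).
  rewrite RintegralZl//; last exact: integrableT_add.
  rewrite RintegralD//.
  rewrite [X in _ + X](_ : _ = A); first by rewrite -/A; field.
  by rewrite /Rintegral sqint_translate.
apply: le_Rintegral => //.
- exact: integrable_norm.
- exact/integrableT_scale/integrableT_add.
- move=> x _; rewrite normrM -(real_normK (num_real (a x))).
  rewrite -(real_normK (num_real (a (x + s)))).
  by have := sqr_ge0 (`|a x| - `|a (x + s)|); nra.
Qed.

Let measurable_Phi_integrand (e : R) :
  measurable_fun [set: R * R] (fun z : R * R => a z.1 * (a (z.1 + e * z.2) * P z.2)).
Proof.
apply: measurable_funM; first exact: measurableT_comp.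
apply: measurable_funM; last exact: measurableT_comp.
by apply: measurableT_comp => //; apply: measurable_funD => //; exact: measurable_funM.
Qed.

(** The substitution $y = x + et$ turns the kernel of width [e] into the fixed density [P], leaving
    [e] only in the argument of [Phi]. *)
Let poisson_smoothing (e : R) : 0 < e ->
  \int[mu]_x (a x * \int[mu]_y (a y * (2 * e / (e ^+ 2 + (x - y) ^+ 2)))) =
  \int[mu]_t (P t * Phi (e * t)).
Proof.
move=> e0.
have mk x : measurable_fun [set: R] (fun y => 2 * e / (e ^+ 2 + (x - y) ^+ 2)).
  apply: continuous_measurable_fun => y; apply: cvgM; first exact: cvg_cst.
  apply: cvgV; first by rewrite gt_eqF// ltr_pwDl ?exprn_gt0// sqr_ge0.
  apply: cvgD; first exact: cvg_cst.
  apply: (@continuous_comp _ _ _ (fun y => x - y) (fun z => z ^+ 2)).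
    by apply: cvgB; [exact: cvg_cst|exact: cvg_id].
  exact: exprn_continuous.
have sub x : \int[mu]_y (a y * (2 * e / (e ^+ 2 + (x - y) ^+ 2))) =
    \int[mu]_t (a (x + e * t) * P t).
  rewrite (@Rintegral_affine _ e x)//; last exact: measurable_funM.
  have iaP : mu.-integrable [set: R] (EFin \o (fun t => a (e * t + x) * P t)).
    exact: (integrableT_bounded_mul (integrable_affine x e0 ia) mP P_le2).
  transitivity (e * \int[mu]_t (e^-1 * (a (e * t + x) * P t))); last first.
    rewrite RintegralZl// mulrA divff ?gt_eqF// mul1r.
    by apply: eq_Rintegral => t _; rewrite addrC.
  congr (e * _); apply: eq_Rintegral => t _; rewrite /P [RHS]mulrCA; congr (_ * _).
  have t0 : 1 + t ^+ 2 != 0 by rewrite gt_eqF// ltr_pwDl// sqr_ge0.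
  rewrite (_ : e ^+ 2 + _ = e ^+ 2 * (1 + t ^+ 2)); last by ring.
  by field; rewrite t0 gt_eqF.
under eq_Rintegral do rewrite sub.
(* The factor [a (x + e * t)] couples the variables, so no product bound is at hand. Integrating in
   [x] first gives at most [A * P t], which is integrable. *)
have fi : (mu \x mu)%E.-integrable [set: R * R]
    (EFin \o (fun z : R * R => a z.1 * (a (z.1 + e * z.2) * P z.2))).
  apply/(integrable21ltyP mu mu).
    by apply/measurable_EFinP; exact: measurable_Phi_integrand.
  apply: (@le_lt_trans _ _ (\int[mu]_t (A * P t)%:E)%E); last first.
    by apply: integrable_lty => //; exact/integrableT_scale/integrable_cauchy.
  apply: ge0_le_integral => //.
  - by move=> t _; apply: integral_ge0.
  - apply: (@measurable_fun_fubini_tonelli_G _ _ _ _ _ mu (fun z : R * R =>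
      `|(a z.1 * (a (z.1 + e * z.2) * P z.2))%:E|)%E) => //.
    apply/measurable_EFinP; apply: measurableT_comp => //.
    exact: measurable_Phi_integrand.
  - by apply/measurable_EFinP; exact: measurable_funM.
  - move=> t _.
    have imt := mul_translate_integrable (e * t).
    have -> : (\int[mu]_x `|(a x * (a (x + e * t) * P t))%:E| =
        \int[mu]_x (P t * `|a x * a (x + e * t)|)%:E)%E.
      by apply: eq_integral => x _ /=; rewrite mulrA normrM (ger0_norm (P_ge0 t)) mulrC.
    rewrite integrableT_EFin_Rintegral; last exact/integrableT_scale/integrable_norm.
    rewrite RintegralZl//; last exact: integrable_norm.
    by rewrite lee_fin mulrC ler_wpM2r.
transitivity (\int[mu]_x \int[mu]_t (a x * (a (x + e * t) * P t))).
  apply: eq_Rintegral => x _; rewrite RintegralZl//.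
  have := integrableT_bounded_mul (integrable_affine x e0 ia) mP P_le2.
  by under eq_fun do rewrite addrC.
rewrite (@Rintegral_fubini _ _ _ _ R mu mu _ fi).
apply: eq_Rintegral => t _ /=.
rewrite /Phi -(RintegralZl (P t) measurableT (mul_translate_integrable (e * t))).
by apply: eq_Rintegral => x _; ring.
Qed.

Lemma plancherel_cos_sin :
  (\int[mu]_u (cos_transform a u ^+ 2 + sin_transform a u ^+ 2)%:E =
   (2 * pi * A)%:E)%E.
Proof.
(* Positive and decreasing to [0], so that the weights increase to [1]. *)
pose e n : R := n.+1%:R^-1.
have e0 n : 0 < e n by rewrite invr_gt0.
pose w n (u : R) := expR (- (e n * `|u|)).
pose S u := cos_transform a u ^+ 2 + sin_transform a u ^+ 2.
have S0 u : 0 <= S u by rewrite addr_ge0 ?sqr_ge0.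
have mS : measurable_fun [set: R] S.
  by apply: measurable_funD; apply: measurable_funX;
    [exact: measurable_cos_transform|exact: measurable_sin_transform].
pose M := \int[mu]_x `|a x|.
have SM u : `|S u| <= M ^+ 2 + M ^+ 2.
  rewrite ger0_norm// lerD// -(real_normK (num_real _)) ler_sqr ?nnegrE ?Rintegral_ge0//;
    apply: normr_Rintegral_mul_le => //.
  - by apply: measurable_funcos; exact: measurable_funM.
  - by move=> x; exact: normr_cos_le1.
  - by apply: measurable_funsin; exact: measurable_funM.
  - by move=> x; exact: normr_sin_le1.
have mw n : measurable_fun [set: R] (w n) := measurable_expR_norm _.
have iw n : mu.-integrable [set: R] (EFin \o w n) := integrable_expR_norm (e0 n).
have wS n : (\int[mu]_u (w n u * S u)%:E = (\int[mu]_t (P t * Phi (e n * t)))%:E)%E.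
  rewrite integrableT_EFin_Rintegral; last exact: (integrableT_bounded_mul (iw n) mS SM).
  rewrite (Rintegral_cos_sin_transform_sqr ia (iw n)) -(poisson_smoothing (e0 n)).
  congr EFin; apply: eq_Rintegral => x _; congr (_ * _).
  by apply: eq_Rintegral => y _; rewrite Rintegral_expR_norm_cos.
have enx (x : R) : e n * x @[n --> \oo] --> 0.
  rewrite -(mul0r x); apply: cvgM; last exact: cvg_cst.
  exact: cvg_harmonic.
(* Integrability of [S] is not yet known: it is a consequence of the identity. Monotone convergence
   does not ask for it. *)
have lhs : (\int[mu]_u (w n u * S u)%:E)%E @[n --> \oo] --> (\int[mu]_u (S u)%:E)%E.
  rewrite (_ : (\int[mu]_u (S u)%:E)%E = (\int[mu]_u limn (fun n => (w n u * S u)%:E))%E).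
    apply: cvg_monotone_convergence => //.
    - by move=> n; apply/measurable_EFinP; apply: measurable_funM => //; exact: mw.
    - by move=> n x _; rewrite lee_fin mulr_ge0// expR_ge0.
    - move=> x _ m n mn; rewrite lee_fin ler_wpM2r// ler_expR lerN2 ler_wpM2r//.
      by rewrite lef_pV2 ?posrE// ler_nat.
  apply: eq_integral => u _; apply/esym/cvg_lim => //.
  apply/fine_cvgP; split; first by apply: nearW.
  have cw : w n u @[n --> \oo] --> expR (- 0).
    apply: (@continuous_cvg _ _ _ _ _ _ expR); first exact: continuous_expR.
    by apply: cvgN; exact: enx.
  have := cvgM cw (cvg_cst (S u)).
  by rewrite oppr0 expR0 mul1r; apply.
have PhiA s : `|Phi s| <= A.
  apply: le_trans (norm_mul_translate_le s); exact: le_normr_Rintegral.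
have mPhi : measurable_fun [set: R] Phi.
  apply: (@measurable_Rintegral2 _ _ _ _ R mu (fun z => a z.2 * a (z.2 + z.1))).
  apply: measurable_funM; first exact: measurableT_comp.
  by apply: measurableT_comp => //; exact: measurable_funD.
(* Dominated by [A * P], since [Phi] is bounded by [A]; the pointwise limit is the continuity of the
   autocorrelation at [0]. *)
have rhs : (\int[mu]_t (P t * Phi (e n * t))%:E)%E @[n --> \oo] -->
    (\int[mu]_t (P t * A)%:E)%E.
  have mPhie n : measurable_fun [set: R] (fun t => (P t * Phi (e n * t))%:E).
    apply/measurable_EFinP; apply: measurable_funM => //.
    by apply: measurableT_comp => //; exact: measurable_funM.
  have iPA : mu.-integrable [set: R] (EFin \o (fun t => A * P t)).
    exact/integrableT_scale/integrable_cauchy.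
  have [] // := @dominated_convergence _ _ _ mu setT measurableT
    (fun n t => (P t * Phi (e n * t))%:E) (fun t => (P t * A)%:E) _ mPhie _ _ iPA _.
  - by apply/measurable_EFinP; exact: measurable_funM.
  - apply: aeW => t _; apply/fine_cvgP; split; first by apply: nearW.
    apply: cvgM; first exact: cvg_cst.
    exact: autocorrelation_cvg ma ia2 (enx t).
  - by apply: aeW => t n _; rewrite lee_fin normrM (ger0_norm (P_ge0 t)) mulrC ler_wpM2r.
have -> : (2 * pi * A)%:E = (\int[mu]_t (P t * A)%:E)%E.
  have -> : (\int[mu]_t (P t * A)%:E = \int[mu]_t (A%:E * (P t)%:E))%E.
    by apply: eq_integral => t _; rewrite mulrC.
  rewrite ge0_integralZl//.
  - by rewrite integral_cauchy -EFinM mulrC.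
  - exact/measurable_EFinP.
  - by move=> t _; rewrite lee_fin.
  - by rewrite lee_fin Rintegral_ge0// => x _; exact: sqr_ge0.
have E n : (\int[mu]_t (P t * Phi (e n * t))%:E = \int[mu]_u (w n u * S u)%:E)%E.
  rewrite wS integrableT_EFin_Rintegral//.
  apply: (integrableT_bounded_mul (@integrable_cauchy R)); last by move=> t; exact: PhiA.
  by apply: measurableT_comp => //; exact: measurable_funM.
by rewrite (eq_cvg _ _ E) in rhs; exact: cvg_unique _ lhs rhs.
Qed.

End one_function.
End plancherel1.

Section plancherel_pair.
Variable R : realType.
Notation mu := (@lebesgue_measure R).

Lemma cos_transformN (a : R -> R) u : cos_transform a (- u) = cos_transform a u.
Proof. by apply: eq_Rintegral => x _; rewrite mulrN cosN. Qed.

Lemma sin_transformN (a : R -> R) u : sin_transform a (- u) = - sin_transform a u.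
Proof.
by rewrite /sin_transform -RintegralN; apply: eq_Rintegral => x _; rewrite mulrN sinN mulrN.
Qed.

(* Right multiplication by [e^{-i x u}] (resp. [e^{-j x u}]) rotates two pairs
   of components of a quaternion; the two sums below are the transforms of one
   such pair.  Their cross terms are odd in [u]. *)
Lemma plancherel_pair (p q : R -> R) :
  mu.-integrable [set: R] (EFin \o p) -> mu.-integrable [set: R] (EFin \o q) ->
  mu.-integrable [set: R] (EFin \o (fun x => p x ^+ 2)) ->
  mu.-integrable [set: R] (EFin \o (fun x => q x ^+ 2)) ->
  (\int[mu]_u ((cos_transform p u + sin_transform q u) ^+ 2 +
               (cos_transform q u - sin_transform p u) ^+ 2)%:E =
   (2 * pi)%:E * \int[mu]_x (p x ^+ 2 + q x ^+ 2)%:E)%E.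
Proof.
move=> ip iq ip2 iq2.
have mCp := measurable_cos_transform ip; have mSp := measurable_sin_transform ip.
have mCq := measurable_cos_transform iq; have mSq := measurable_sin_transform iq.
set G := fun u => (cos_transform p u + sin_transform q u) ^+ 2 +
  (cos_transform q u - sin_transform p u) ^+ 2.
have G0 u : (0 <= (G u)%:E)%E by rewrite lee_fin addr_ge0 ?sqr_ge0.
have mG : measurable_fun [set: R] (fun u => (G u)%:E).
  apply/measurable_EFinP; apply: measurable_funD; apply: measurable_funX;
    [exact: measurable_funD|exact: measurable_funB].
have mGN : measurable_fun [set: R] (fun u => (G (- u))%:E).
  by apply: (@measurableT_comp _ _ _ _ _ _ (fun u => (G u)%:E)).
have S0 (c s : R) : (0 <= (c ^+ 2 + s ^+ 2)%:E)%E by rewrite lee_fin addr_ge0 ?sqr_ge0.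
have mS (c s : R -> R) : measurable_fun [set: R] c -> measurable_fun [set: R] s ->
    measurable_fun [set: R] (fun u => (c u ^+ 2 + s u ^+ 2)%:E).
  by move=> mc ms; apply/measurable_EFinP; apply: measurable_funD; exact: measurable_funX.
(* Replacing [u] by [- u] in one copy makes the cross terms cancel inside a sum of nonnegative
   functions, so they are never integrated by themselves. *)
have GG : (\int[mu]_u (G u)%:E + \int[mu]_u (G u)%:E =
    (2 * (2 * pi * \int[mu]_x p x ^+ 2 + 2 * pi * \int[mu]_x q x ^+ 2))%:E)%E.
  rewrite {2}(ge0_integral_oppr mG G0) -ge0_integralD//.
  rewrite EFinM [X in (_ * X)%E]EFinD -!plancherel_cos_sin// -ge0_integralD//; [|exact: mS..].
  rewrite -ge0_integralZl//; last 2 first.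
  - by apply: emeasurable_funD; exact: mS.
  - by move=> x _; rewrite adde_ge0.
  apply: eq_integral => u _; rewrite /G !cos_transformN !sin_transformN.
  by rewrite -!EFinD -EFinM; congr EFin; ring.
have -> : (\int[mu]_x (p x ^+ 2 + q x ^+ 2)%:E =
    (\int[mu]_x p x ^+ 2 + \int[mu]_x q x ^+ 2)%:E)%E.
  have mp2 := integrableT_measurable ip2; have mq2 := integrableT_measurable iq2.
  rewrite EFinD -!integrableT_EFin_Rintegral// -ge0_integralD//.
  - by move=> x _; rewrite lee_fin sqr_ge0.
  - exact/measurable_EFinP.
  - by move=> x _; rewrite lee_fin sqr_ge0.
  - exact/measurable_EFinP.
(* The finite right side excludes infinite values, after which the doubled equation can be halved in
   the reals. *)
move: GG; case: (\int[mu]_u _)%E => [r||]//= [].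
rewrite -EFinM => rr; congr EFin.
have half (x y z : R) : x + x = 2 * (y + z) -> x = y + z by move=> *; lra.
by rewrite (half _ _ _ rr) -mulrDr.
Qed.

End plancherel_pair.

(** * Plancherel's identity in dimension two *)

(** Needed in [Rintegral_mul_prod], where a factor leaves the inner integral for every [y],
    including those whose section is not integrable. *)
Lemma RintegralZl_measurable d (T : measurableType d) (R : realType)
    (mu : {measure set T -> \bar R}) (k : R) (f : T -> R) :
  measurable_fun [set: T] f -> \int[mu]_x (k * f x) = k * \int[mu]_x f x.
Proof.
move=> mf.
have maxM (r b : R) : 0 < r -> (maxe (r * b)%:E 0 = r%:E * maxe b%:E 0)%E.
  move=> r0; have [b0|b0] := leP 0 b.
    by rewrite !max_l ?lee_fin// mulr_ge0// ltW.
  by rewrite !max_r ?lee_fin ?mule0// ?ltW// pmulr_rlt0.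
have pos (r : R) : 0 < r -> \int[mu]_x (r * f x) = r * \int[mu]_x f x.
  move=> r0; pose g x := (f x)%:E.
  have mg : measurable_fun [set: T] g by exact/measurable_EFinP.
  rewrite /Rintegral [X in fine X = _]integralE [X in _ = _ * fine X]integralE.
  have -> : (\int[mu]_x (fun x => (r * f x)%:E)^\+ x = r%:E * \int[mu]_x g^\+ x)%E.
    rewrite -ge0_integralZl//; [|exact: measurable_funepos|by rewrite lee_fin ltW].
    by apply: eq_integral => x _; rewrite !funeposE maxM.
  have -> : (\int[mu]_x (fun x => (r * f x)%:E)^\- x = r%:E * \int[mu]_x g^\- x)%E.
    rewrite -ge0_integralZl//; [|exact: measurable_funeneg|by rewrite lee_fin ltW].
    by apply: eq_integral => x _; rewrite !funenegE -!EFinN -mulrN maxM.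
  have := @integral_ge0 _ _ _ mu setT _ (fun x _ => funepos_ge0 g x).
  have := @integral_ge0 _ _ _ mu setT _ (fun x _ => funeneg_ge0 g x).
  move: (\int[mu]_x g^\+ _)%E (\int[mu]_x g^\- _)%E.
  by move=> [p||] [q||]//= _ _; rewrite ?gt0_muley ?lte_fin//= ?mulr0// -mulrBr.
have [k0|k0|->] := ltgtP k 0; last first.
- by under eq_Rintegral do rewrite mul0r; rewrite /Rintegral integral0 mul0r.
- exact: pos.
- rewrite -[in RHS](opprK k) mulNr -pos ?oppr_gt0// -RintegralN.
  by apply: eq_Rintegral => x _; rewrite mulNr opprK.
Qed.

(** * Partial transforms and their sections *)

Section iterated_transforms.
Variable R : realType.
Notation mu := (@lebesgue_measure R).
Notation mu2 := (@lebesgue_measure R \x @lebesgue_measure R)%E.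
Implicit Types (h p q : R * R -> R).

Lemma integrable_mul_prod h (X Y : R -> R) : mu2.-integrable [set: R * R] (EFin \o h) ->
  measurable_fun [set: R] X -> measurable_fun [set: R] Y ->
  (forall x, `|X x| <= 1) -> (forall y, `|Y y| <= 1) ->
  mu2.-integrable [set: R * R] (EFin \o (fun z => h z * X z.1 * Y z.2)).
Proof.
move=> ih mX mY X1 Y1.
apply: (integrableT_bounded_mul (M := 1)) => [||z]; [|exact: measurableT_comp|exact: Y1].
by apply: (integrableT_bounded_mul ih (M := 1)) => [|z]; [exact: measurableT_comp|exact: X1].
Qed.

Lemma Rintegral_mul_prod h (X Y : R -> R) : mu2.-integrable [set: R * R] (EFin \o h) ->
  measurable_fun [set: R] X -> measurable_fun [set: R] Y ->
  (forall x, `|X x| <= 1) -> (forall y, `|Y y| <= 1) ->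
  \int[mu2]_z (h z * X z.1 * Y z.2) =
  \int[mu]_y ((\int[mu]_x (h (x, y) * X x)) * Y y).
Proof.
move=> ih mX mY X1 Y1.
rewrite -(Rintegral21_prod (integrable_mul_prod ih mX mY X1 Y1)).
apply: eq_Rintegral => y _ /=; rewrite mulrC -RintegralZl_measurable.
  by apply: eq_Rintegral => x _; rewrite mulrC.
apply: measurable_funM => //.
exact: (measurableT_comp (integrableT_measurable ih) (@measurable_pair2 _ _ _ _ y)).
Qed.

Lemma integrable_swap h : mu2.-integrable [set: R * R] (EFin \o h) ->
  mu2.-integrable [set: R * R] (EFin \o (fun z => h (z.2, z.1))).
Proof.
move=> ih; have mh := integrableT_measurable ih.
have mhs : measurable_fun [set: R * R] (fun z : R * R => h (z.2, z.1)).
  by apply: measurableT_comp => //; exact: measurable_fun_pair.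
apply/(integrable12ltyP mu mu); first exact/measurable_EFinP.
exact: ((integrable21ltyP mu mu (measurable_int _ ih)).1 ih).
Qed.

(** With [X] a cosine or sine of fixed frequency, this gives integrability in [y] of the partial
    transform at every frequency, not just at almost every one. *)
Lemma integrable_section_mul h (X : R -> R) : mu2.-integrable [set: R * R] (EFin \o h) ->
  measurable_fun [set: R] X -> (forall x, `|X x| <= 1) ->
  mu.-integrable [set: R] (EFin \o (fun y => \int[mu]_x (h (x, y) * X x))).
Proof.
move=> ih mX X1.
have iy := integrableT_bounded_mul (integrable_swap ih)
  (measurableT_comp mX (@measurable_snd _ _ _ _)) (fun z => X1 z.2).
exact: (integrable_Rintegral2 iy).
Qed.

Let sqr2_ge0 (x y : R) : (0 <= (x ^+ 2 + y ^+ 2)%:E)%E.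
Proof. by rewrite lee_fin addr_ge0 ?sqr_ge0. Qed.

Lemma measurable_cos_transform_param p : measurable_fun [set: R * R] p ->
  measurable_fun [set: R * R] (fun z => cos_transform (fun x => p (z.1, x)) z.2).
Proof.
move=> mp.
apply: (@measurable_Rintegral2 _ _ _ _ R mu
  (fun w : (R * R) * R => p (w.1.1, w.2) * cos (w.2 * w.1.2))).
apply: measurable_funM.
  apply: measurableT_comp => //; apply: measurable_fun_pair => //.
  exact: measurableT_comp.
apply: measurable_funcos; apply: measurable_funM => //; exact: measurableT_comp.
Qed.

Lemma measurable_sin_transform_param p : measurable_fun [set: R * R] p ->
  measurable_fun [set: R * R] (fun z => sin_transform (fun x => p (z.1, x)) z.2).
Proof.
move=> mp.
apply: (@measurable_Rintegral2 _ _ _ _ R mu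
  (fun w : (R * R) * R => p (w.1.1, w.2) * sin (w.2 * w.1.2))).
apply: measurable_funM.
  apply: measurableT_comp => //; apply: measurable_fun_pair => //.
  exact: measurableT_comp.
apply: measurable_funsin; apply: measurable_funM => //; exact: measurableT_comp.
Qed.

(** Integrability is asked of almost every section only, because the second application is to
    partial transforms, which need not be integrable over the plane. Tonelli's theorem needs no
    more, the integrands being nonnegative. *)
Lemma plancherel_pair_param p q :
  measurable_fun [set: R * R] p -> measurable_fun [set: R * R] q ->
  {ae mu, forall y, mu.-integrable [set: R] (EFin \o (fun x => p (y, x)))} ->
  {ae mu, forall y, mu.-integrable [set: R] (EFin \o (fun x => q (y, x)))} ->
  mu2.-integrable [set: R * R] (EFin \o (fun z => p z ^+ 2)) ->
  mu2.-integrable [set: R * R] (EFin \o (fun z => q z ^+ 2)) ->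
  (\int[mu2]_z ((cos_transform (fun x => p (z.1, x)) z.2 +
                 sin_transform (fun x => q (z.1, x)) z.2) ^+ 2 +
                (cos_transform (fun x => q (z.1, x)) z.2 -
                 sin_transform (fun x => p (z.1, x)) z.2) ^+ 2)%:E =
   (2 * pi)%:E * \int[mu2]_z (p z ^+ 2 + q z ^+ 2)%:E)%E.
Proof.
move=> mp mq ip iq ip2 iq2.
pose G (z : R * R) := ((cos_transform (fun x => p (z.1, x)) z.2 +
    sin_transform (fun x => q (z.1, x)) z.2) ^+ 2 +
  (cos_transform (fun x => q (z.1, x)) z.2 -
    sin_transform (fun x => p (z.1, x)) z.2) ^+ 2)%:E.
have mG : measurable_fun [set: R * R] G.
  have mCp := measurable_cos_transform_param mp.
  have mSp := measurable_sin_transform_param mp.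
  have mCq := measurable_cos_transform_param mq.
  have mSq := measurable_sin_transform_param mq.
  apply/measurable_EFinP.
  exact: (measurable_funD (measurable_funX 2 (measurable_funD mCp mSq))
    (measurable_funX 2 (measurable_funB mCq mSp))).
have G0 z : (0 <= G z)%E by exact: sqr2_ge0.
pose H (z : R * R) := (p z ^+ 2 + q z ^+ 2)%:E.
have mH : measurable_fun [set: R * R] H.
  by apply/measurable_EFinP; apply: measurable_funD; exact: measurable_funX.
have H0 z : (0 <= H z)%E by exact: sqr2_ge0.
have mF := measurable_fun_fubini_tonelli_F (m2 := mu) H mH H0.
transitivity (\int[mu]_y \int[mu]_u G (y, u))%E; first exact: fubini_tonelli1.
transitivity ((2 * pi)%:E * \int[mu]_y \int[mu]_x H (y, x))%E; last first.
  congr (_ * _)%E; apply/esym; exact: (@fubini_tonelli1 _ _ _ _ _ mu mu H).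
rewrite -ge0_integralZl//; last 2 first.
- by move=> y _; exact: integral_ge0.
- by rewrite lee_fin mulr_ge0// pi_ge0.
apply: ae_eq_integral => //.
- exact: measurable_fun_fubini_tonelli_F.
- exact: measurable_funeM.
have ip2s : {ae mu, forall y, mu.-integrable [set: R] (EFin \o (fun x => p (y, x) ^+ 2))}.
  exact: (ae_integrable1 ip2).
have iq2s : {ae mu, forall y, mu.-integrable [set: R] (EFin \o (fun x => q (y, x) ^+ 2))}.
  exact: (ae_integrable1 iq2).
pose sint (r : R * R -> R) y := mu.-integrable [set: R] (EFin \o (fun x => r (y, x))).
have ipq : {ae mu, forall y, (sint p y /\ sint q y) /\
    (sint (fun z => p z ^+ 2) y /\ sint (fun z => q z ^+ 2) y)}.
  by apply: (@filterI _ _ (ae_filter_ringOfSetsType mu));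
    apply: (@filterI _ _ (ae_filter_ringOfSetsType mu)).
move: ipq; apply: (@filterS _ _ (ae_filter_ringOfSetsType mu)) => y.
by move=> [[ipy iqy] [ip2y iq2y]] _; exact: (plancherel_pair ipy iqy ip2y iq2y).
Qed.

End iterated_transforms.

Section plancherel2.
Variable R : realType.
Notation mu := (@lebesgue_measure R).
Notation mu2 := (@lebesgue_measure R \x @lebesgue_measure R)%E.
Implicit Types (h p q : R * R -> R).

Lemma ge0_integral_swap (f : R * R -> \bar R) : measurable_fun [set: R * R] f ->
  (forall z, 0 <= f z)%E ->
  (\int[mu2]_z f (z.2, z.1) = \int[mu2]_z f z)%E.
Proof.
move=> mf f0.
transitivity (\int[mu]_x \int[mu]_y f (y, x))%E.
  apply: (@fubini_tonelli1 _ _ _ _ _ mu mu (fun z => f (z.2, z.1))) => //.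
  by apply: measurableT_comp => //; exact: measurable_fun_pair.
by apply/esym; exact: (@fubini_tonelli2 _ _ _ _ _ mu mu f).
Qed.

(** In the transforms indexed by [1], [z.1] is a frequency while [z.2] is still a position; those
    indexed by [2] act on the second coordinate and leave the first alone. *)
Definition cos_transform1 h (z : R * R) : R := cos_transform (fun x => h (x, z.2)) z.1.
Definition sin_transform1 h (z : R * R) : R := sin_transform (fun x => h (x, z.2)) z.1.
Definition cos_transform2 h (z : R * R) : R := cos_transform (fun y => h (z.1, y)) z.2.
Definition sin_transform2 h (z : R * R) : R := sin_transform (fun y => h (z.1, y)) z.2.

Lemma measurable_swap h : measurable_fun [set: R * R] h ->
  measurable_fun [set: R * R] (fun z : R * R => h (z.2, z.1)).
Proof. by move=> mh; apply: measurableT_comp => //; exact: measurable_fun_pair. Qed.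

Lemma measurable_cos_transform1 h : measurable_fun [set: R * R] h ->
  measurable_fun [set: R * R] (cos_transform1 h).
Proof.
by move=> /measurable_swap/measurable_cos_transform_param/measurable_swap.
Qed.

Lemma measurable_sin_transform1 h : measurable_fun [set: R * R] h ->
  measurable_fun [set: R * R] (sin_transform1 h).
Proof.
by move=> /measurable_swap/measurable_sin_transform_param/measurable_swap.
Qed.

Lemma integrable_cos_transform1 h u : mu2.-integrable [set: R * R] (EFin \o h) ->
  mu.-integrable [set: R] (EFin \o (fun y => cos_transform1 h (u, y))).
Proof.
move=> ih; apply: (@integrable_section_mul _ h (fun x => cos (x * u))) => //.
  by apply: measurable_funcos; exact: measurable_funM.
by move=> x; exact: normr_cos_le1.
Qed.

Lemma integrable_sin_transform1 h u : mu2.-integrable [set: R * R] (EFin \o h) ->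
  mu.-integrable [set: R] (EFin \o (fun y => sin_transform1 h (u, y))).
Proof.
move=> ih; apply: (@integrable_section_mul _ h (fun x => sin (x * u))) => //.
  by apply: measurable_funsin; exact: measurable_funM.
by move=> x; exact: normr_sin_le1.
Qed.

Lemma plancherel_pair1 p q :
  mu2.-integrable [set: R * R] (EFin \o p) -> mu2.-integrable [set: R * R] (EFin \o q) ->
  mu2.-integrable [set: R * R] (EFin \o (fun z => p z ^+ 2)) ->
  mu2.-integrable [set: R * R] (EFin \o (fun z => q z ^+ 2)) ->
  (\int[mu2]_z ((cos_transform1 p z + sin_transform1 q z) ^+ 2 +
                (cos_transform1 q z - sin_transform1 p z) ^+ 2)%:E =
   (2 * pi)%:E * \int[mu2]_z (p z ^+ 2 + q z ^+ 2)%:E)%E.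
Proof.
move=> ip iq ip2 iq2.
have mp := integrableT_measurable ip; have mq := integrableT_measurable iq.
have sec h : mu2.-integrable [set: R * R] (EFin \o h) ->
    {ae mu, forall y, mu.-integrable [set: R] (EFin \o (fun x => h (x, y)))}.
  by move=> ih; exact: (ae_integrable2 ih).
have := @plancherel_pair_param R (fun z => p (z.2, z.1)) (fun z => q (z.2, z.1))
  (measurable_swap mp) (measurable_swap mq) (sec _ ip) (sec _ iq)
  (integrable_swap ip2) (integrable_swap iq2).
rewrite (@ge0_integral_swap (fun z => (p z ^+ 2 + q z ^+ 2)%:E)); last 2 first.
- by apply/measurable_EFinP; apply: measurable_funD; exact: measurable_funX.
- by move=> z; rewrite lee_fin addr_ge0 ?sqr_ge0.
move=> <-.
apply: (@ge0_integral_swap (fun z => (((cos_transform (fun x => p (x, z.1)) z.2 +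
  sin_transform (fun x => q (x, z.1)) z.2) ^+ 2 +
  (cos_transform (fun x => q (x, z.1)) z.2 -
  sin_transform (fun x => p (x, z.1)) z.2) ^+ 2)%:E))); last first.
  by move=> z; rewrite lee_fin addr_ge0 ?sqr_ge0.
have mCp := measurable_cos_transform_param (measurable_swap mp).
have mSp := measurable_sin_transform_param (measurable_swap mp).
have mCq := measurable_cos_transform_param (measurable_swap mq).
have mSq := measurable_sin_transform_param (measurable_swap mq).
apply/measurable_EFinP.
exact: (measurable_funD (measurable_funX 2 (measurable_funD mCp mSq))
  (measurable_funX 2 (measurable_funB mCq mSp))).
Qed.

Lemma ge0_integral_EFinD d (T : measurableType d) (m : {measure set T -> \bar R})
    (f g : T -> R) : measurable_fun [set: T] f -> measurable_fun [set: T] g ->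
  (forall x, 0 <= f x) -> (forall x, 0 <= g x) ->
  (\int[m]_x (f x + g x)%:E = \int[m]_x (f x)%:E + \int[m]_x (g x)%:E)%E.
Proof.
move=> mf mg f0 g0; rewrite -ge0_integralD//; try exact/measurable_EFinP;
  by move=> x _; rewrite lee_fin.
Qed.

Lemma measurable_sqrD d (T : measurableType d) (f g : T -> R) :
  measurable_fun [set: T] f -> measurable_fun [set: T] g ->
  measurable_fun [set: T] (fun x => f x ^+ 2 + g x ^+ 2).
Proof. by move=> mf mg; apply: measurable_funD; exact: measurable_funX. Qed.

Lemma integrable_sqr_add d (T : measurableType d) (m : {measure set T -> \bar R})
    (f g : T -> R) : measurable_fun [set: T] f -> measurable_fun [set: T] g ->
  (\int[m]_x (f x ^+ 2 + g x ^+ 2)%:E < +oo)%E ->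
  m.-integrable [set: T] (EFin \o (fun x => f x ^+ 2)) /\
  m.-integrable [set: T] (EFin \o (fun x => g x ^+ 2)).
Proof.
move=> mf mg fgoo.
have fg : m.-integrable [set: T] (EFin \o (fun x => f x ^+ 2 + g x ^+ 2)).
  apply: ge0_integrableT_lty => // [|x]; last by rewrite addr_ge0 ?sqr_ge0.
  by apply: measurable_funD; exact: measurable_funX.
split; apply: integrable_le_norm fg _; try exact: measurable_funX.
  by move=> x; rewrite ger0_norm ?sqr_ge0// lerDl sqr_ge0.
by move=> x; rewrite ger0_norm ?sqr_ge0// lerDr sqr_ge0.
Qed.

Section four_components.
Variables a b c d : R * R -> R.
Hypothesis ia : mu2.-integrable [set: R * R] (EFin \o a).
Hypothesis ib : mu2.-integrable [set: R * R] (EFin \o b).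
Hypothesis ic : mu2.-integrable [set: R * R] (EFin \o c).
Hypothesis id : mu2.-integrable [set: R * R] (EFin \o d).
Hypothesis ia2 : mu2.-integrable [set: R * R] (EFin \o (fun z => a z ^+ 2)).
Hypothesis ib2 : mu2.-integrable [set: R * R] (EFin \o (fun z => b z ^+ 2)).
Hypothesis ic2 : mu2.-integrable [set: R * R] (EFin \o (fun z => c z ^+ 2)).
Hypothesis id2 : mu2.-integrable [set: R * R] (EFin \o (fun z => d z ^+ 2)).

(** [A], [B], [C], [D] are the components along $1,i,j,k$ of $\int f\,e^{-ixu}\,dx$ for $f =
    a+bi+cj+dk$. The signs in [C] and [D] come from $ji=-k$ and $ki=j$. *)
Let A z := cos_transform1 a z + sin_transform1 b z.
Let B z := cos_transform1 b z - sin_transform1 a z.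
Let C z := cos_transform1 c z - sin_transform1 d z.
Let D z := cos_transform1 d z + sin_transform1 c z.

Let plancherel_pair2 P Q : (forall u, mu.-integrable [set: R] (EFin \o (fun y => P (u, y)))) ->
  (forall u, mu.-integrable [set: R] (EFin \o (fun y => Q (u, y)))) ->
  measurable_fun [set: R * R] P -> measurable_fun [set: R * R] Q ->
  mu2.-integrable [set: R * R] (EFin \o (fun z => P z ^+ 2)) ->
  mu2.-integrable [set: R * R] (EFin \o (fun z => Q z ^+ 2)) ->
  (\int[mu2]_z ((cos_transform2 P z + sin_transform2 Q z) ^+ 2 +
                (cos_transform2 Q z - sin_transform2 P z) ^+ 2)%:E =
   (2 * pi)%:E * \int[mu2]_z (P z ^+ 2 + Q z ^+ 2)%:E)%E.
Proof.
by move=> iP iQ mP mQ iP2 iQ2; apply: plancherel_pair_param => //; exact: aeW.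
Qed.

(** Right multiplication by $e^{-ixu}$ rotates the pairs $(a,b)$ and $(d,c)$, whereas $e^{-jyv}$
    rotates $(A,C)$ and $(B,D)$. Each step preserves the sum of all four squared norms up to $2\pi$,
    so the regrouping in between is harmless. *)
Lemma plancherel_four :
  (\int[mu2]_z ((cos_transform2 A z + sin_transform2 C z) ^+ 2 +
                (cos_transform2 C z - sin_transform2 A z) ^+ 2 +
                ((cos_transform2 B z + sin_transform2 D z) ^+ 2 +
                (cos_transform2 D z - sin_transform2 B z) ^+ 2))%:E =
   ((2 * pi) ^+ 2)%:E *
     \int[mu2]_z (a z ^+ 2 + b z ^+ 2 + (c z ^+ 2 + d z ^+ 2))%:E)%E.
Proof.
have [ma mb] := (integrableT_measurable ia, integrableT_measurable ib).
have [mc md] := (integrableT_measurable ic, integrableT_measurable id).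
have mA : measurable_fun [set: R * R] A.
  exact: (measurable_funD (measurable_cos_transform1 ma) (measurable_sin_transform1 mb)).
have mB : measurable_fun [set: R * R] B.
  exact: (measurable_funB (measurable_cos_transform1 mb) (measurable_sin_transform1 ma)).
have mC : measurable_fun [set: R * R] C.
  exact: (measurable_funB (measurable_cos_transform1 mc) (measurable_sin_transform1 md)).
have mD : measurable_fun [set: R * R] D.
  exact: (measurable_funD (measurable_cos_transform1 md) (measurable_sin_transform1 mc)).
have iA u : mu.-integrable [set: R] (EFin \o (fun y => A (u, y))).
  exact: (integrableT_add (integrable_cos_transform1 u ia) (integrable_sin_transform1 u ib)).
have iB u : mu.-integrable [set: R] (EFin \o (fun y => B (u, y))).
  exact: (integrableT_sub (integrable_cos_transform1 u ib) (integrable_sin_transform1 u ia)).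
have iC u : mu.-integrable [set: R] (EFin \o (fun y => C (u, y))).
  exact: (integrableT_sub (integrable_cos_transform1 u ic) (integrable_sin_transform1 u id)).
have iD u : mu.-integrable [set: R] (EFin \o (fun y => D (u, y))).
  exact: (integrableT_add (integrable_cos_transform1 u id) (integrable_sin_transform1 u ic)).
have AB := plancherel_pair1 ia ib ia2 ib2.
have DC := plancherel_pair1 id ic id2 ic2.
have fin2 (p q : R * R -> R) : mu2.-integrable [set: R * R] (EFin \o (fun z => p z ^+ 2)) ->
    mu2.-integrable [set: R * R] (EFin \o (fun z => q z ^+ 2)) ->
    ((2 * pi)%:E * \int[mu2]_z (p z ^+ 2 + q z ^+ 2)%:E < +oo)%E.
  move=> ip2 iq2; rewrite integrableT_EFin_Rintegral ?ltry//.
  exact: integrableT_add.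
(* The first step has a finite right side, which supplies the square integrability assumed by the
   second. *)
have [iA2 iB2] : mu2.-integrable [set: R * R] (EFin \o (fun z => A z ^+ 2)) /\
    mu2.-integrable [set: R * R] (EFin \o (fun z => B z ^+ 2)).
  by apply: integrable_sqr_add => //; rewrite AB; exact: fin2.
have [iD2 iC2] : mu2.-integrable [set: R * R] (EFin \o (fun z => D z ^+ 2)) /\
    mu2.-integrable [set: R * R] (EFin \o (fun z => C z ^+ 2)).
  by apply: integrable_sqr_add => //; rewrite DC; exact: fin2.
have m2 P Q : measurable_fun [set: R * R] P -> measurable_fun [set: R * R] Q ->
    measurable_fun [set: R * R] (fun z => (cos_transform2 P z + sin_transform2 Q z) ^+ 2 +
      (cos_transform2 Q z - sin_transform2 P z) ^+ 2).
  move=> mP mQ.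
  have mCP := measurable_cos_transform_param mP.
  have mSP := measurable_sin_transform_param mP.
  have mCQ := measurable_cos_transform_param mQ.
  have mSQ := measurable_sin_transform_param mQ.
  exact: (measurable_sqrD (measurable_funD mCP mSQ) (measurable_funB mCQ mSP)).
have sqD (x y : R) : 0 <= x ^+ 2 + y ^+ 2 by rewrite addr_ge0 ?sqr_ge0.
rewrite ge0_integral_EFinD//; [|exact: m2|exact: m2].
rewrite (plancherel_pair2 iA iC mA mC iA2 iC2) (plancherel_pair2 iB iD mB mD iB2 iD2).
rewrite -ge0_muleDr ?integral_ge0//; last 2 first.
- by move=> z _; rewrite lee_fin.
- by move=> z _; rewrite lee_fin.
rewrite -ge0_integral_EFinD//; [|exact: measurable_sqrD|exact: measurable_sqrD].
have -> : (\int[mu2]_z (A z ^+ 2 + C z ^+ 2 + (B z ^+ 2 + D z ^+ 2))%:E =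
    \int[mu2]_z (A z ^+ 2 + B z ^+ 2 + (D z ^+ 2 + C z ^+ 2))%:E)%E.
  by apply: eq_integral => z _; congr EFin; ring.
rewrite ge0_integral_EFinD//; [|exact: measurable_sqrD|exact: measurable_sqrD].
rewrite AB DC -ge0_muleDr ?integral_ge0//; last 2 first.
- by move=> z _; rewrite lee_fin.
- by move=> z _; rewrite lee_fin.
rewrite muleA -EFinM -expr2; congr (_ * _)%E.
rewrite -ge0_integral_EFinD//; [|exact: measurable_sqrD|exact: measurable_sqrD].
by apply: eq_integral => z _; congr EFin; ring.
Qed.

End four_components.
End plancherel2.

(** * The quaternion Fourier transform *)

Section quaternion_transform.
Variable R : realType.
Notation mu := (@lebesgue_measure R).
Notation mu2 := (@lebesgue_measure R \x @lebesgue_measure R)%E.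
Notation L1 h := (mu2.-integrable [set: R * R] (EFin \o h)).
Notation L2 h := (mu2.-integrable [set: R * R] (EFin \o (fun z => h z ^+ 2))).
Implicit Types (f g : R * R -> quat R).

Definition qintegrable f :=
  [/\ L1 (fun x => qre (f x)), L1 (fun x => qim_i (f x)),
      L1 (fun x => qim_j (f x)) & L1 (fun x => qim_k (f x))].

Definition qsquare_integrable f :=
  [/\ L2 (fun x => qre (f x)), L2 (fun x => qim_i (f x)),
      L2 (fun x => qim_j (f x)) & L2 (fun x => qim_k (f x))].

Definition qnorm2 (q : quat R) : R :=
  qre q ^+ 2 + qim_i q ^+ 2 + (qim_j q ^+ 2 + qim_k q ^+ 2).

Lemma qabs_sqr q : qabs q ^+ 2 = qnorm2 q.
Proof.
rewrite /qabs qmul_conj /= mulr1 sqr_sqrtr; last by rewrite !addr_ge0 ?sqr_ge0.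
by rewrite /qnorm2 addrA.
Qed.

Lemma qnorm2_ge0 q : 0 <= qnorm2 q. Proof. by rewrite !addr_ge0 ?sqr_ge0. Qed.

Lemma cos_transformD (p q : R -> R) u : mu.-integrable [set: R] (EFin \o p) ->
  mu.-integrable [set: R] (EFin \o q) ->
  cos_transform (fun x => p x + q x) u = cos_transform p u + cos_transform q u.
Proof.
move=> ip iq; rewrite /cos_transform -RintegralD//; try exact: integrable_mul_cos.
by apply: eq_Rintegral => x _; rewrite mulrDl.
Qed.

Lemma sin_transform_sub (p q : R -> R) u : mu.-integrable [set: R] (EFin \o p) ->
  mu.-integrable [set: R] (EFin \o q) ->
  sin_transform (fun x => p x - q x) u = sin_transform p u - sin_transform q u.
Proof.
move=> ip iq; rewrite /sin_transform -RintegralB//; try exact: integrable_mul_sin.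
by apply: eq_Rintegral => x _; rewrite mulrBl.
Qed.

Lemma qftr_integrandE (q : quat R) (s t : R) :
  let: Quat a b c d := q in
  q * qexp (- s *: quat_i R) * qexp (- t *: quat_j R) =
  Quat (a * cos s * cos t + b * sin s * cos t + c * cos s * sin t - d * sin s * sin t)
       (b * cos s * cos t - a * sin s * cos t + d * cos s * sin t + c * sin s * sin t)
       (c * cos s * cos t - d * sin s * cos t - a * cos s * sin t - b * sin s * sin t)
       (d * cos s * cos t + c * sin s * cos t - b * cos s * sin t + a * sin s * sin t).
Proof.
case: q => a b c d; rewrite qexp_i qexp_j !cosN !sinN.
by congr Quat => /=; ring.
Qed.

Lemma cos_transform_opp (p : R -> R) u :
  cos_transform (fun x => - p x) u = - cos_transform p u.
Proof.
by rewrite /cos_transform -RintegralN; apply: eq_Rintegral => x _; rewrite mulNr.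
Qed.

Lemma sin_transform_opp (p : R -> R) u :
  sin_transform (fun x => - p x) u = - sin_transform p u.
Proof.
by rewrite /sin_transform -RintegralN; apply: eq_Rintegral => x _; rewrite mulNr.
Qed.

Lemma cos_transform1_opp (h : R * R -> R) z :
  cos_transform1 (fun z => - h z) z = - cos_transform1 h z.
Proof. by rewrite /cos_transform1 cos_transform_opp. Qed.

Lemma sin_transform1_opp (h : R * R -> R) z :
  sin_transform1 (fun z => - h z) z = - sin_transform1 h z.
Proof. by rewrite /sin_transform1 sin_transform_opp. Qed.

(** All four components of the quaternion transform are instances of this formula, with some of the
    arguments replaced by their opposites. *)
Lemma double_transform (p q r s : R * R -> R) (w : R * R) :
  L1 p -> L1 q -> L1 r -> L1 s ->
  \int[mu2]_z (p z * cos (z.1 * w.1) * cos (z.2 * w.2) +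
    q z * sin (z.1 * w.1) * cos (z.2 * w.2) +
    r z * cos (z.1 * w.1) * sin (z.2 * w.2) -
    s z * sin (z.1 * w.1) * sin (z.2 * w.2)) =
  cos_transform2 (fun z => cos_transform1 p z + sin_transform1 q z) w +
  sin_transform2 (fun z => cos_transform1 r z - sin_transform1 s z) w.
Proof.
move=> ip iq ir is_.
have mc (u : R) : measurable_fun [set: R] (fun x => cos (x * u)).
  by apply: measurable_funcos; exact: measurable_funM.
have ms (u : R) : measurable_fun [set: R] (fun x => sin (x * u)).
  by apply: measurable_funsin; exact: measurable_funM.
have c1 (u x : R) : `|cos (x * u)| <= 1 by exact: normr_cos_le1.
have s1 (u x : R) : `|sin (x * u)| <= 1 by exact: normr_sin_le1.
rewrite /cos_transform2 /sin_transform2.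
rewrite cos_transformD; [|exact: integrable_cos_transform1|exact: integrable_sin_transform1].
rewrite sin_transform_sub;
  [|exact: integrable_cos_transform1|exact: integrable_sin_transform1].
have Icc := integrable_mul_prod ip (mc w.1) (mc w.2) (c1 w.1) (c1 w.2).
have Isc := integrable_mul_prod iq (ms w.1) (mc w.2) (s1 w.1) (c1 w.2).
have Ics := integrable_mul_prod ir (mc w.1) (ms w.2) (c1 w.1) (s1 w.2).
have Iss := integrable_mul_prod is_ (ms w.1) (ms w.2) (s1 w.1) (s1 w.2).
rewrite (RintegralB measurableT (integrableT_add (integrableT_add Icc Isc) Ics) Iss).
rewrite (RintegralD measurableT (integrableT_add Icc Isc) Ics).
rewrite (RintegralD measurableT Icc Isc).
rewrite (Rintegral_mul_prod ip (mc w.1) (mc w.2) (c1 w.1) (c1 w.2)).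
rewrite (Rintegral_mul_prod iq (ms w.1) (mc w.2) (s1 w.1) (c1 w.2)).
rewrite (Rintegral_mul_prod ir (mc w.1) (ms w.2) (c1 w.1) (s1 w.2)).
rewrite (Rintegral_mul_prod is_ (ms w.1) (ms w.2) (s1 w.1) (s1 w.2)).
by rewrite addrA.
Qed.

Lemma qftr_components f (w : R * R) : qintegrable f ->
  let a z := qre (f z) in let b z := qim_i (f z) in
  let c z := qim_j (f z) in let d z := qim_k (f z) in
  let A z := cos_transform1 a z + sin_transform1 b z in
  let B z := cos_transform1 b z - sin_transform1 a z in
  let C z := cos_transform1 c z - sin_transform1 d z in
  let D z := cos_transform1 d z + sin_transform1 c z in
  qftr f w =
  Quat (cos_transform2 A w + sin_transform2 C w) (cos_transform2 B w + sin_transform2 D w)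
       (cos_transform2 C w - sin_transform2 A w) (cos_transform2 D w - sin_transform2 B w).
Proof.
move=> [ia ib ic id] a b c d A B C D.
have opp h : L1 h -> L1 (fun z => - h z) by exact: integrableT_opp.
have E z := qftr_integrandE (f z) (z.1 * w.1) (z.2 * w.2).
rewrite /qftr /qintegral; congr Quat.
- rewrite -(double_transform w ia ib ic id).
  by apply: eq_Rintegral => z _; have := E z; rewrite /a /b /c /d; case: (f z) => ? ? ? ? ->.
- transitivity (cos_transform2 (fun z => cos_transform1 b z + sin_transform1 (fun z => - a z) z) w +
    sin_transform2 (fun z => cos_transform1 d z - sin_transform1 (fun z => - c z) z) w).
    rewrite -(double_transform w ib (opp _ ia) id (opp _ ic)).
    apply: eq_Rintegral => z _; have := E z; rewrite /a /b /c /d; case: (f z) => ? ? ? ? ->.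
    by rewrite /= !mulNr opprK.
  by congr (_ + _); congr (cos_transform _ _) || congr (sin_transform _ _);
    apply/funext => y; rewrite sin_transform1_opp ?opprK.
- transitivity (cos_transform2 (fun z => cos_transform1 c z + sin_transform1 (fun z => - d z) z) w +
    sin_transform2 (fun z => cos_transform1 (fun z => - a z) z - sin_transform1 b z) w).
    rewrite -(double_transform w ic (opp _ id) (opp _ ia) ib).
    apply: eq_Rintegral => z _; have := E z; rewrite /a /b /c /d; case: (f z) => ? ? ? ? ->.
    by rewrite /= !mulNr.
  congr (_ + _); first by congr (cos_transform _ _); apply/funext => y; rewrite sin_transform1_opp.
  rewrite /sin_transform2 -sin_transform_opp.
  by congr (sin_transform _ _); apply/funext => y; rewrite cos_transform1_opp opprD.
- transitivity (cos_transform2 (fun z => cos_transform1 d z + sin_transform1 c z) w +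
    sin_transform2 (fun z => cos_transform1 (fun z => - b z) z -
      sin_transform1 (fun z => - a z) z) w).
    rewrite -(double_transform w id ic (opp _ ib) (opp _ ia)).
    apply: eq_Rintegral => z _; have := E z; rewrite /a /b /c /d; case: (f z) => ? ? ? ? ->.
    by rewrite /= !mulNr opprK.
  congr (_ + _); rewrite /sin_transform2 -sin_transform_opp.
  congr (sin_transform _ _); apply/funext => y.
  by rewrite cos_transform1_opp sin_transform1_opp opprD.
Qed.

Lemma qftr_plancherel f : qintegrable f -> qsquare_integrable f ->
  (\int[mu2]_w (qnorm2 (qftr f w))%:E =
   ((2 * pi) ^+ 2)%:E * \int[mu2]_x (qnorm2 (f x))%:E)%E.
Proof.
move=> fi fi2; have [ia ib ic id] := fi; have [ia2 ib2 ic2 id2] := fi2.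
rewrite -(plancherel_four ia ib ic id ia2 ib2 ic2 id2).
apply: eq_integral => w _; rewrite (qftr_components w fi) /qnorm2 /=.
by congr EFin; rewrite addrACA.
Qed.

Lemma qftr_measurable f : qintegrable f -> qmeasurable (qftr f).
Proof.
move=> fi; have [ia ib ic id] := fi.
have [ma mb] := (integrableT_measurable ia, integrableT_measurable ib).
have [mc md] := (integrableT_measurable ic, integrableT_measurable id).
have mA := measurable_funD (measurable_cos_transform1 ma) (measurable_sin_transform1 mb).
have mB := measurable_funB (measurable_cos_transform1 mb) (measurable_sin_transform1 ma).
have mC := measurable_funB (measurable_cos_transform1 mc) (measurable_sin_transform1 md).
have mD := measurable_funD (measurable_cos_transform1 md) (measurable_sin_transform1 mc).
have E w := qftr_components w fi.
split; under eq_fun do rewrite E /=.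
- exact: (measurable_funD (measurable_cos_transform_param mA) (measurable_sin_transform_param mC)).
- exact: (measurable_funD (measurable_cos_transform_param mB) (measurable_sin_transform_param mD)).
- exact: (measurable_funB (measurable_cos_transform_param mC) (measurable_sin_transform_param mA)).
- exact: (measurable_funB (measurable_cos_transform_param mD) (measurable_sin_transform_param mB)).
Qed.

End quaternion_transform.

(** * From norms to quaternion-valued inner products *)

Section polarization.
Variable R : realType.
Notation mu := (@lebesgue_measure R).
Notation mu2 := (@lebesgue_measure R \x @lebesgue_measure R)%E.
Notation L1 h := (mu2.-integrable [set: R * R] (EFin \o h)).
Implicit Types (f g : R * R -> quat R).

Lemma qintegrable_integrand f (w : R * R) : qintegrable f ->
  qintegrable (fun x =>
    f x * qexp (- (x.1 * w.1) *: quat_i R) * qexp (- (x.2 * w.2) *: quat_j R)).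
Proof.
move=> [ia ib ic id].
have mc (u : R) : measurable_fun [set: R] (fun x => cos (x * u)).
  by apply: measurable_funcos; exact: measurable_funM.
have ms (u : R) : measurable_fun [set: R] (fun x => sin (x * u)).
  by apply: measurable_funsin; exact: measurable_funM.
have c1 (u x : R) : `|cos (x * u)| <= 1 by exact: normr_cos_le1.
have s1 (u x : R) : `|sin (x * u)| <= 1 by exact: normr_sin_le1.
have Icc h (ih : L1 h) := integrable_mul_prod ih (mc w.1) (mc w.2) (c1 w.1) (c1 w.2).
have Isc h (ih : L1 h) := integrable_mul_prod ih (ms w.1) (mc w.2) (s1 w.1) (c1 w.2).
have Ics h (ih : L1 h) := integrable_mul_prod ih (mc w.1) (ms w.2) (c1 w.1) (s1 w.2).
have Iss h (ih : L1 h) := integrable_mul_prod ih (ms w.1) (ms w.2) (s1 w.1) (s1 w.2).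
have E x := qftr_integrandE (f x) (x.1 * w.1) (x.2 * w.2).
split.
- have := integrableT_sub (integrableT_add (integrableT_add (Icc _ ia) (Isc _ ib)) (Ics _ ic))
    (Iss _ id).
  congr (integrable _ _ _); apply/funext => x /=.
  by have := E x; case: (f x) => ? ? ? ? ->.
- have := integrableT_add (integrableT_add (integrableT_sub (Icc _ ib) (Isc _ ia)) (Ics _ id))
    (Iss _ ic).
  congr (integrable _ _ _); apply/funext => x /=.
  by have := E x; case: (f x) => ? ? ? ? ->.
- have := integrableT_sub (integrableT_sub (integrableT_sub (Icc _ ic) (Isc _ id)) (Ics _ ia))
    (Iss _ ib).
  congr (integrable _ _ _); apply/funext => x /=.
  by have := E x; case: (f x) => ? ? ? ? ->.
- have := integrableT_add (integrableT_sub (integrableT_add (Icc _ id) (Isc _ ic)) (Ics _ ib))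
    (Iss _ ia).
  congr (integrable _ _ _); apply/funext => x /=.
  by have := E x; case: (f x) => ? ? ? ? ->.
Qed.

Lemma qintegrableD f g : qintegrable f -> qintegrable g ->
  qintegrable (fun x => f x + g x).
Proof.
by move=> [? ? ? ?] [? ? ? ?]; split; exact: integrableT_add.
Qed.

Lemma qintegrableN f : qintegrable f -> qintegrable (fun x => - f x).
Proof. by move=> [? ? ? ?]; split; exact: integrableT_opp. Qed.

Lemma integrableT_sqrD (p q : R * R -> R) :
  measurable_fun [set: R * R] p -> measurable_fun [set: R * R] q ->
  L1 (fun x => p x ^+ 2) -> L1 (fun x => q x ^+ 2) -> L1 (fun x => (p x + q x) ^+ 2).
Proof.
move=> mp mq ip iq.
apply: integrable_le_norm (integrableT_scale 2 (integrableT_add ip iq)) _.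
  by apply: measurable_funX; exact: measurable_funD.
by move=> x; rewrite ger0_norm ?sqr_ge0//; have := sqr_ge0 (p x - q x); nra.
Qed.

Lemma qsquare_integrableD f g : qmeasurable f -> qmeasurable g ->
  qsquare_integrable f -> qsquare_integrable g ->
  qsquare_integrable (fun x => f x + g x).
Proof.
by move=> [? ? ? ?] [? ? ? ?] [? ? ? ?] [? ? ? ?]; split; exact: integrableT_sqrD.
Qed.

Lemma qsquare_integrableN f : qsquare_integrable f -> qsquare_integrable (fun x => - f x).
Proof.
have sqrN (h : R * R -> R) : (fun x => (- h x) ^+ 2) = (fun x => h x ^+ 2).
  by apply/funext => x; rewrite sqrrN.
by move=> [? ? ? ?]; split => /=; rewrite sqrN.
Qed.

Lemma qmeasurableN f : qmeasurable f -> qmeasurable (fun x => - f x).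
Proof. by move=> [? ? ? ?]; split; exact: measurable_funN. Qed.

Lemma qintegralD f g : qintegrable f -> qintegrable g ->
  qintegral (fun x => f x + g x) = qintegral f + qintegral g.
Proof.
by move=> [? ? ? ?] [? ? ? ?]; rewrite /qintegral; congr Quat;
  exact: (RintegralD measurableT).
Qed.

Lemma qintegralN f : qintegral (fun x => - f x) = - qintegral f.
Proof. by rewrite /qintegral; congr Quat; exact: RintegralN. Qed.

Lemma qftrD f g w : qintegrable f -> qintegrable g ->
  qftr (fun x => f x + g x) w = qftr f w + qftr g w.
Proof.
move=> fi gi; rewrite /qftr -qintegralD; try exact: qintegrable_integrand.
by congr qintegral; apply/funext => x; rewrite !mulrDl.
Qed.

Lemma qftrN f w : qftr (fun x => - f x) w = - qftr f w.
Proof.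
rewrite /qftr -qintegralN.
by congr qintegral; apply/funext => x; rewrite !mulNr.
Qed.

Lemma integrable_qnorm2 f : qsquare_integrable f -> L1 (fun x => qnorm2 (f x)).
Proof. by move=> [? ? ? ?]; do 2 apply: integrableT_add => //; exact: integrableT_add. Qed.

(** The real part of $p\tilde q$ is the Euclidean inner product of $\mathbb{R}^4$. *)
Lemma qnorm2_polarization (p q : quat R) :
  qre (p * qconj q) = 4^-1 * (qnorm2 (p + q) - qnorm2 (p - q)).
Proof.
case: p => a b c d; case: q => a' b' c' d'.
by rewrite /qnorm2 /=; field.
Qed.

Lemma qre_qinner f g : qmeasurable f -> qmeasurable g ->
  qsquare_integrable f -> qsquare_integrable g ->
  qre (qinner f g) = 4^-1 * (\int[mu2]_x qnorm2 (f x + g x) - \int[mu2]_x qnorm2 (f x - g x)).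
Proof.
move=> mf mg f2 g2.
have add2 := integrable_qnorm2 (qsquare_integrableD mf mg f2 g2).
have sub2 := integrable_qnorm2
  (qsquare_integrableD mf (qmeasurableN mg) f2 (qsquare_integrableN g2)).
rewrite -(RintegralB measurableT add2 sub2).
rewrite -(RintegralZl _ measurableT (integrableT_sub add2 sub2)).
by apply: eq_Rintegral => x _; exact: qnorm2_polarization.
Qed.

Lemma qnorm2_ge_components (q : quat R) :
  [/\ qre q ^+ 2 <= qnorm2 q, qim_i q ^+ 2 <= qnorm2 q,
      qim_j q ^+ 2 <= qnorm2 q & qim_k q ^+ 2 <= qnorm2 q].
Proof.
case: q => x y z t; rewrite /qnorm2 /=.
have := sqr_ge0 x; have := sqr_ge0 y; have := sqr_ge0 z; have := sqr_ge0 t.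
by move=> *; split; lra.
Qed.

Lemma qftr_square_integrable f : qintegrable f -> qsquare_integrable f ->
  qsquare_integrable (qftr f).
Proof.
move=> fi f2; have [ma mb mc md] := qftr_measurable fi.
have n2 : L1 (fun w => qnorm2 (qftr f w)).
  apply: ge0_integrableT_lty => [|w|]; last first.
  - rewrite qftr_plancherel// integrableT_EFin_Rintegral ?ltry//.
    exact: integrable_qnorm2.
  - exact: qnorm2_ge0.
  - exact: (measurable_funD (measurable_sqrD ma mb) (measurable_sqrD mc md)).
have le := integrable_le_norm _ n2.
have le4 w := qnorm2_ge_components (qftr f w).
by split; apply: le; try exact: measurable_funX; move=> w;
  rewrite ger0_norm ?sqr_ge0//; have [] := le4 w.
Qed.

Lemma Rintegral_qnorm2_qftr f : qintegrable f -> qsquare_integrable f ->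
  \int[mu2]_w qnorm2 (qftr f w) = (2 * pi) ^+ 2 * \int[mu2]_x qnorm2 (f x).
Proof.
move=> fi f2; rewrite [LHS]/Rintegral qftr_plancherel//.
by rewrite integrableT_EFin_Rintegral//; exact: integrable_qnorm2.
Qed.

Lemma qmeasurable_of_qintegrable f : qintegrable f -> qmeasurable f.
Proof.
by move=> [ia ib ic id]; split; [exact: integrableT_measurable ia|
  exact: integrableT_measurable ib|exact: integrableT_measurable ic|
  exact: integrableT_measurable id].
Qed.

Lemma qre_qinner_qftr f g : qintegrable f -> qintegrable g ->
  qsquare_integrable f -> qsquare_integrable g ->
  qre (qinner (qftr f) (qftr g)) = (2 * pi) ^+ 2 * qre (qinner f g).
Proof.
move=> fi gi f2 g2.
have mf := qmeasurable_of_qintegrable fi; have mg := qmeasurable_of_qintegrable gi.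
rewrite qre_qinner; try exact: qftr_measurable; try exact: qftr_square_integrable.
rewrite qre_qinner// mulrCA; congr (_ * _); rewrite mulrBr.
rewrite -!Rintegral_qnorm2_qftr.
- congr (_ - _); apply: eq_Rintegral => w _; first by rewrite qftrD.
  by rewrite qftrD ?qftrN//; exact: qintegrableN.
- by apply: qintegrableD => //; exact: qintegrableN.
- apply: qsquare_integrableD => //; [exact: qmeasurableN|exact: qsquare_integrableN].
- exact: qintegrableD.
- exact: qsquare_integrableD.
Qed.

Lemma mull_unitsE (q : quat R) :
  [/\ - quat_i R * q = Quat (qim_i q) (- qre q) (qim_k q) (- qim_j q),
      - quat_j R * q = Quat (qim_j q) (- qim_k q) (- qre q) (qim_i q) &
      - quat_k R * q = Quat (qim_k q) (qim_j q) (- qim_i q) (- qre q)].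
Proof. by case: q => ? ? ? ?; split; congr Quat => /=; ring. Qed.

Lemma mull_units_funE f :
  [/\ (fun x => - quat_i R * f x) =
        (fun x => Quat (qim_i (f x)) (- qre (f x)) (qim_k (f x)) (- qim_j (f x))),
      (fun x => - quat_j R * f x) =
        (fun x => Quat (qim_j (f x)) (- qim_k (f x)) (- qre (f x)) (qim_i (f x))) &
      (fun x => - quat_k R * f x) =
        (fun x => Quat (qim_k (f x)) (qim_j (f x)) (- qim_i (f x)) (- qre (f x)))].
Proof. by split; apply/funext => x; have [] := mull_unitsE (f x). Qed.

(** For these units, left multiplication permutes the components up to sign. [RintegralN] then
    suffices, and no integrability has to be checked. *)
Lemma qintegral_mull (e : quat R) f : e \in [:: - quat_i R; - quat_j R; - quat_k R] ->
  qintegral (fun x => e * f x) = e * qintegral f.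
Proof.
have [Ei Ej Ek] := mull_unitsE (qintegral f); have [fi fj fk] := mull_units_funE f.
rewrite !inE => /or3P[] /eqP ->; rewrite (Ei, Ej, Ek) (fi, fj, fk);
  by rewrite /qintegral /= !RintegralN.
Qed.

Lemma qre_mull_units (q : quat R) :
  [/\ qim_i q = qre (- quat_i R * q), qim_j q = qre (- quat_j R * q) &
      qim_k q = qre (- quat_k R * q)].
Proof. by case: q => ? ? ? ?; split => /=; ring. Qed.

Lemma qintegrable_mull (e : quat R) f : e \in [:: - quat_i R; - quat_j R; - quat_k R] ->
  qintegrable f -> qintegrable (fun x => e * f x).
Proof.
move=> he [ia ib ic id]; move: he; have [fi fj fk] := mull_units_funE f.
by rewrite !inE => /or3P[] /eqP ->; rewrite (fi, fj, fk); split => //;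
  exact: integrableT_opp.
Qed.

Lemma qsquare_integrable_mull (e : quat R) f :
  e \in [:: - quat_i R; - quat_j R; - quat_k R] ->
  qsquare_integrable f -> qsquare_integrable (fun x => e * f x).
Proof.
have sqrN (h : R * R -> R) : (fun x => (- h x) ^+ 2) = (fun x => h x ^+ 2).
  by apply/funext => x; rewrite sqrrN.
move=> he [ia ib ic id]; move: he; have [fi fj fk] := mull_units_funE f.
by rewrite !inE => /or3P[] /eqP ->; rewrite (fi, fj, fk); split; rewrite /= ?sqrN.
Qed.

Lemma qinner_qftr f g : qintegrable f -> qintegrable g ->
  qsquare_integrable f -> qsquare_integrable g ->
  qinner f g = (1 / (2 * pi) ^+ 2 : R) *: qinner (qftr f) (qftr g).
Proof.
move=> fi gi f2 g2.
have pi2 : (2 * pi) ^+ 2 != 0 :> R by rewrite expf_neq0// mulf_neq0// gt_eqF// pi_gt0.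
have mull e F G : e \in [:: - quat_i R; - quat_j R; - quat_k R] ->
    e * qinner F G = qinner (fun x => e * F x) G.
  move=> he; rewrite /qinner -qintegral_mull//.
  by congr qintegral; apply/funext => x; rewrite mulrA.
have main e : e \in [:: - quat_i R; - quat_j R; - quat_k R] ->
    qre (e * qinner (qftr f) (qftr g)) = (2 * pi) ^+ 2 * qre (e * qinner f g).
  move=> he; rewrite !mull// -qre_qinner_qftr//; last 2 first.
  - exact: qintegrable_mull.
  - exact: qsquare_integrable_mull.
  (* The exponentials multiply on the right, so [e] passes through them by associativity. *)
  congr (qre (qinner _ _)); apply/funext => w; rewrite /qftr -qintegral_mull//.
  by congr qintegral; apply/funext => x; rewrite !mulrA.
have unscale (p q : quat R) : qre q = (2 * pi) ^+ 2 * qre p ->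
    qim_i q = (2 * pi) ^+ 2 * qim_i p -> qim_j q = (2 * pi) ^+ 2 * qim_j p ->
    qim_k q = (2 * pi) ^+ 2 * qim_k p -> p = (1 / (2 * pi) ^+ 2 : R) *: q.
  case: p => a b c d; case: q => ? ? ? ? /= -> -> -> ->.
  have K (x : R) : 1 / (2 * pi) ^+ 2 * ((2 * pi) ^+ 2 * x) = x by rewrite mulrA mul1r mulVf ?mul1r.
  by rewrite -[RHS]/(qscale _ _) /qscale /= !K.
have [iE jE kE] := qre_mull_units (qinner f g).
have [iE' jE' kE'] := qre_mull_units (qinner (qftr f) (qftr g)).
apply: unscale.
- exact: qre_qinner_qftr.
- by rewrite iE iE'; apply: main; rewrite !inE eqxx.
- by rewrite jE jE'; apply: main; rewrite !inE eqxx orbT.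
- by rewrite kE kE'; apply: main; rewrite !inE eqxx !orbT.
Qed.

(** One Borel representative serves both hypotheses. The finite integrals transfer to it even if [f]
    is not Borel, and each component is bounded by the modulus. *)
Lemma ae_rep_integrable f : in_L1 f -> in_L2 f ->
  exists g, [/\ qintegrable g, qsquare_integrable g &
    {ae lebesgue2 R, forall x, f x = g x}].
Proof.
move=> [[f1 mf1 ff1] foo] [_ foo2]; exists f1.
have [ma mb mc md] := mf1.
have ae_eq (phi : quat R -> \bar R) :
    (\int[lebesgue2 R]_x phi (f x) = \int[lebesgue2 R]_x phi (f1 x))%E.
  apply: ae_eq_integral_nonmeasurable.
  by apply: (@filterS _ _ (ae_filter_ringOfSetsType (lebesgue2 R)) _ _ _ ff1) => x ->.
have n2 : L1 (fun x => qnorm2 (f1 x)).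
  apply: ge0_integrableT_lty => [|x|]; last first.
  - apply: le_lt_trans foo2; rewrite (ae_eq (fun q => (qabs q ^+ 2)%:E)).
    by under [leRHS]eq_integral do rewrite qabs_sqr.
  - exact: qnorm2_ge0.
  - exact: (measurable_funD (measurable_sqrD ma mb) (measurable_sqrD mc md)).
have n1 : L1 (fun x => qabs (f1 x)).
  apply: ge0_integrableT_lty => [|x|]; last first.
  - by apply: le_lt_trans foo; rewrite (ae_eq (fun q => (qabs q)%:E)).
  - exact: sqrtr_ge0.
  - have -> : (fun x => qabs (f1 x)) = (fun x => Num.sqrt (qnorm2 (f1 x))).
      by apply/funext => x; rewrite -qabs_sqr sqrtr_sqr ger0_norm// sqrtr_ge0.
    apply: measurableT_comp; last exact: integrableT_measurable n2.
    by apply: continuous_measurable_fun; exact: sqrt_continuous.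
have le2 x := qnorm2_ge_components (f1 x).
have le1 x : [/\ `|qre (f1 x)| <= qabs (f1 x), `|qim_i (f1 x)| <= qabs (f1 x),
    `|qim_j (f1 x)| <= qabs (f1 x) & `|qim_k (f1 x)| <= qabs (f1 x)].
  have sqrle y : y ^+ 2 <= qnorm2 (f1 x) -> `|y| <= qabs (f1 x).
    by rewrite -qabs_sqr -(real_normK (num_real y)) ler_sqr ?nnegrE// sqrtr_ge0.
  by have [? ? ? ?] := le2 x; split; exact: sqrle.
split => //.
- by split; apply: integrable_le_norm n1 _ => // x; have [] := le1 x.
- by split; apply: integrable_le_norm n2 _; try exact: measurable_funX; move=> x;
    rewrite ger0_norm ?sqr_ge0//; have [] := le2 x.
Qed.

End polarization.

Theorem theorem3p2 (R : realType) (f g : R * R -> quat R)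
    (hf1 : in_L1 f) (hf2 : in_L2 f) (hg1 : in_L1 g) (hg2 : in_L2 g) :
  [/\ in_L2 (qftr f), in_L2 (qftr g) &
      qinner f g = (1 / (2 * pi) ^+ 2 : R) *: qinner (qftr f) (qftr g)].
Proof.
have [f1 [f1i f1s ff1]] := ae_rep_integrable hf1 hf2.
have [g1 [g1i g1s gg1]] := ae_rep_integrable hg1 hg2.
(* Functions equal almost everywhere have the same transform at every frequency, so [qftr f] is
   itself a Borel function. *)
have qftrE (h h1 : R * R -> quat R) : {ae lebesgue2 R, forall x, h x = h1 x} -> qftr h = qftr h1.
  move=> hh1; apply/funext => w; apply: qintegral_ae_eq.
  by apply: (@filterS _ _ (ae_filter_ringOfSetsType (lebesgue2 R)) _ _ _ hh1) => x ->.
have L2 (h : R * R -> quat R) : qintegrable h -> qsquare_integrable h -> in_L2 (qftr h).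
  move=> hi hs; split.
    by exists (qftr h); [exact: qftr_measurable|exact: aeW].
  under eq_integral do rewrite qabs_sqr.
  exact: (integrable_lty measurableT (integrable_qnorm2 (qftr_square_integrable hi hs))).
rewrite (qftrE _ _ ff1) (qftrE _ _ gg1); split; [exact: L2..|].
rewrite -qinner_qftr//; apply: qintegral_ae_eq.
move: gg1; apply: (@filterS2 _ _ (ae_filter_ringOfSetsType (lebesgue2 R)) _ _ _ _ ff1) => x.
by move=> -> ->.
Qed.
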